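(* Let $p$ be a prime with $p\equiv 3\pmod 8$, let $s\ge 1$, $q=p^s$, and let $m\ge 3$ be an integer with $2^{m+1}\mid(q-1)$. Let $n\ge 1$ and let $N$ be the number of $(x_1,\dots,x_n)\in\mathbb F_q^n$ with $x_1^{2^m}+\dots+x_n^{2^m}=0$. For $r=2,3,\dots,m$ let $A_r,B_r$ be integers with $$p^{s/2^{r-2}}=A_r^2+2B_r^2,\qquad A_r\equiv -1\pmod 4,\qquad p\nmid A_r.$$ If $m=3$ then \begin{align*} N=\,&q^{n-1}+\frac{q-1}{8q}\Bigl[2\cdot\left((q^{\frac12}+4B_3q^{\frac14})^n+(q^{\frac12}-4B_3q^{\frac14})^n\right)+2q^{\frac n2}\\ &+\left(-3q^{\frac12}+4A_3q^{\frac14}\right)^n+\left(-3q^{\frac12}-4A_3q^{\frac14}\right)^n\Bigr]. \end{align*} If $m\ge 4$ then \begin{align*} N=\,&q^{n-1}+\frac{q-1}{2^mq}\cdot\Bigl[2^{m-2}\cdot\Bigl((q^{\frac12}+4B_3q^{\frac14})^n+(q^{\frac12}-4B_3q^{\frac14})^n\Bigr)\\ &+2^{m-3}\cdot\Bigl((q^{\frac12}+8B_4q^{\frac38})^n+(q^{\frac12}-8B_4q^{\frac38})^n\Bigr)\\ &+\sum_{t=2}^{m-3}2^{m-t-2}\Bigl((-3q^{\frac12}+\sum_{r=3}^t 2^{r-1}A_rq^{\frac{2^{r-2}-1}{2^{r-1}}}-2^t A_{t+1}q^{\frac{2^{t-1}-1}{2^t}}+2^{t+2} B_{t+3}q^{\frac{2^{t+1}-1}{2^{t+2}}})^n\\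 &\qquad+(-3q^{\frac12}+\sum_{r=3}^t 2^{r-1}A_rq^{\frac{2^{r-2}-1}{2^{r-1}}}-2^t A_{t+1}q^{\frac{2^{t-1}-1}{2^t}}-2^{t+2} B_{t+3}q^{\frac{2^{t+1}-1}{2^{t+2}}})^n\Bigr)\\ &+2\cdot\Bigl(-3q^{\frac 12}+\sum_{r=3}^{m-2} 2^{r-1}A_rq^{\frac{2^{r-2}-1}{2^{r-1}}}-2^{m-2} A_{m-1}q^{\frac{2^{m-3}-1}{2^{m-2}}}\Bigr)^n\\ &+\Bigl(-3q^{\frac 12}+\sum_{r=3}^{m-1}2^{r-1}A_r q^{\frac{2^{r-2}-1}{2^{r-1}}}-2^{m-1}A_m q^{\frac{2^{m-2}-1}{2^{m-1}}}\Bigr)^n\\ &+\Bigl(-3q^{\frac 12}+\sum_{r=3}^{m}2^{r-1}A_r q^{\frac{2^{r-2}-1}{2^{r-1}}}\Bigr)^n\Bigr]. \end{align*}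
   Context: Powers $q^{a}$ with rational $a$ denote positive real powers. Empty sums (e.g. $\sum_{t=2}^{1}$ or $\sum_{r=3}^{2}$) are zero. Under the hypotheses, $2^{r-2}\mid s$ for $r\le m$, so $p^{s/2^{r-2}}$ is an integer; the conditions determine $A_r$ uniquely and $B_r$ up to sign, and the formula holds for either choice of signs. *)

(* Defs.v *)
From HB Require Import structures.
From mathcomp Require Import all_boot all_order all_algebra all_field.
From mathcomp Require Import all_classical all_reals all_analysis.
Set Implicit Arguments. Unset Strict Implicit. Unset Printing Implicit Defensive.

(* Main.v *)
(** Let S(a) be the sum of psi (a x^(2^m)) over x in F_q, for a nontrivial additive
    character psi.  Then q N is q^n plus the sum of S(a)^n over a <> 0, and S(a)
    depends only on the class of a modulo 2^m-th powers, so the 2^m values of S are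
    needed.  Each is a combination of the Gauss sums G_r of characters chi_r of
    order 2^r, r <= m.

    Since p = 3 mod 8, the powers of p are the residues 1 and 3 mod 8 modulo 2^r,
    so Frobenius invariance puts G_r in Z[sqrt(-2)] and leaves only G_r and its
    conjugate among the characters of order 2^r.  The product formula
    G(chi) G(chi eta) = G(chi^2) G(eta) gives G_1 = G_2 = -sqrt q and
    G_(r+1)^2 = - sqrt q G_r for r >= 3, while G_3^2 = - sqrt q J with
    J = J(chi_3, chi_3) of norm q.  Modulo p, J is a binomial coefficient prime to
    p, hence J = +- A_2 +- B_2 sqrt(-2) by uniqueness of such representations; the
    recursion then gives G_r = q^((2^(r-2) - 1) / 2^(r-1)) (A_r +- B_r sqrt(-2)) up
    to a sign, which is found modulo 4 from the fact that - sqrt q G_r is again the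
    square of a Gauss sum.  This last point uses a character of order 2^(m+1). *)

Require Import Defs.
From HB Require Import structures.
From mathcomp Require Import all_boot all_order all_algebra all_field.
From mathcomp Require Import ring zify.
Set Implicit Arguments. Unset Strict Implicit. Unset Printing Implicit Defensive.
Import Order.TTheory GRing.Theory Num.Theory.

(** * Powers of a prime p = 3 mod 8 *)

(** The shape of the formula comes from evaluating S at g^k with k = 2^t u, u odd, and grouping the
    characters by exact order 2^r. At g^k such a character takes a value of order 2^(r-t), or 1 if r
    <= t, so the group contributes the rational part of G_r in full for r <= t, the same with a
    minus sign for r = t+1, nothing for r = t+2, only the coefficient of sqrt(-2) for r = t+3, with
    sign (-2/u), and nothing beyond. Both signs are equally frequent among the u, so the signs of
    the B_r do not matter.

    The obstacle is the sign of each Gauss sum, since the recursion knows only squares; integrality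
    supplies it. For G_1 it is the integrality of a sum of psi over the fourth powers. For higher
    orders a Gauss sum is a Gauss sum of the prime field times an Eisenstein sum (a character sum
    over the elements of trace 1). The latter lies in Z[sqrt(-2)] by Frobenius, the former has
    square p^2 or -p, or is -p itself, so norm and real part of the square become integers that can
    be compared modulo 4. *)

Section PrimeThreeModEight.
Variable p : nat.
Hypothesis p8 : p %% 8 = 3.

Lemma exp_even_mod8 k : ~~ odd k -> p ^ k %% 8 = 1.
Proof.
move=> ek; rewrite -(even_halfK ek) -mul2n expnM -modnXm.
by rewrite -(modnXm 2) p8 -[(3 ^ 2) %% 8]/1 exp1n.
Qed.

Lemma exp_odd_mod8 k : odd k -> p ^ k %% 8 = 3.
Proof.
case: k => // k /= ek; rewrite expnS -modnMm exp_even_mod8 // p8 //.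
Qed.

(** p^2 = 9 mod 16, so p^2 - 1 has 2-adic valuation exactly 3, and each squaring raises the
    valuation by one. The oddness of [u] is the point: modulo 2^(k+4) this power is 1 plus half the
    modulus. *)
Lemma exp_two_pow_step k :
  exists2 u, odd u & p ^ (2 ^ k.+1) = (u * 2 ^ k.+3).+1.
Proof.
elim: k => [|k [u ou IHk]].
  exists (8 * (p %/ 8) ^ 2 + 6 * (p %/ 8) + 1).
    by rewrite addn1 oddS oddD !oddM.
  by rewrite {1}(divn_eq p 8) p8; lia.
exists (u + u ^ 2 * 2 ^ k.+2); first by rewrite oddD oddM (expnS 2 k.+1) (oddM 2) andbF addbF.
have -> : p ^ (2 ^ k.+2) = (p ^ (2 ^ k.+1)) ^ 2 by rewrite -expnM -expnSr.
rewrite IHk.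
have -> : 2 ^ k.+4 = 4 * 2 ^ k.+2 by rewrite !expnS; lia.
have -> : 2 ^ k.+3 = 2 * 2 ^ k.+2 by rewrite !expnS; lia.
by move: (2 ^ k.+2) => w; rewrite -!mulnn; lia.
Qed.

Lemma expn_succ_two_pow u j t : odd u -> 0 < j ->
  exists2 v, odd v = odd t & (u * 2 ^ j).+1 ^ t = (v * 2 ^ j).+1.
Proof.
move=> ou j0; elim: t => [|t [v ov IHt]]; first by exists 0.
exists (u + v + u * v * 2 ^ j); last by rewrite expnS IHt; nia.
by case: j j0 {IHt} => // j _; rewrite !oddD !oddM expnS oddM /= andbF addbF ou ov.
Qed.

Lemma exp_two_pow_mul k t :
  exists2 v, odd v = odd t & p ^ (2 ^ k.+1 * t) = (v * 2 ^ k.+3).+1.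
Proof.
have [u ou hu] := exp_two_pow_step k.
by rewrite expnM hu; apply: expn_succ_two_pow.
Qed.

(** p has order 2^(k+1) modulo 2^(k+3). This converts the hypothesis on q - 1 into divisibility of
    s. *)
Lemma exp_pred_dvd_two_pow k s :
  (2 ^ k.+3 %| p ^ s - 1) = (2 ^ k.+1 %| s).
Proof.
apply/idP/idP => [|/dvdnP[t ->]]; last first.
  have [v _] := exp_two_pow_mul k t.
  by rewrite mulnC => ->; rewrite subn1 /= dvdn_mull.
elim: k => [|k IHk].
  move=> /dvdnP[t ht]; rewrite dvdn2; apply/negP=> os.
  have := exp_odd_mod8 os; have p0 : 0 < p by case: (p) p8.
  by have := expn_gt0 p s; rewrite p0 /=; lia.
move=> d; have /IHk/dvdnP[t e] : 2 ^ k.+3 %| p ^ s - 1.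
  by apply: dvdn_trans d; rewrite dvdn_exp2l.
have [v ov hv] := exp_two_pow_mul k t.
have : 2 ^ k.+4 %| v * 2 ^ k.+3 by move: d; rewrite e mulnC hv subn1.
rewrite (expnS 2 k.+3) dvdn_pmul2r ?expn_gt0 // dvdn2 ov => et.
by rewrite e expnS dvdn_pmul2r ?expn_gt0 // dvdn2.
Qed.

(** The residues 1 and 3 mod 8 form a group of order 2^(k+1) modulo 2^(k+3), which p generates. The
    exponent is lifted one binary digit of the modulus at a time. *)
Lemma odd_residue_is_power k j : j %% 8 \in [:: 1; 3] ->
  exists i, j = p ^ i %[mod 2 ^ k.+3].
Proof.
move=> j8; elim: k => [|k [i IHk]].
  move: j8; rewrite !inE => /orP[]/eqP e.
    by exists 0; rewrite e.
  by exists 1; rewrite e expn1 p8.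
set K := k.+3 in IHk *.
have par a b rho : odd a = odd b ->
    a * 2 ^ K + rho = b * 2 ^ K + rho %[mod 2 ^ K.+1].
  move=> ab; have step c : c * 2 ^ K + rho = odd c * 2 ^ K + rho %[mod 2 ^ K.+1].
    rewrite -{1}(odd_double_half c) mulnDl -muln2 -mulnA -expnS addnAC -modnDmr.
    by rewrite modnMl addn0.
  by rewrite step [RHS]step ab.
have ej := divn_eq j (2 ^ K); have ep := divn_eq (p ^ i) (2 ^ K).
have [eo|no] := eqVneq (odd (j %/ 2 ^ K)) (odd (p ^ i %/ 2 ^ K)).
  by exists i; rewrite {1}ej [in RHS]ep IHk; apply: par.
(* Here [p ^ i] and [j] differ in binary digit K; the extra factor 1 + u 2^K, with u odd, corrects
   that digit and keeps the lower ones. *)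
have [u ou hu] := exp_two_pow_step k.
exists (i + 2 ^ k.+1); rewrite expnD hu -/K.
have -> : p ^ i * (u * 2 ^ K).+1
   = (p ^ i %/ 2 ^ K + p ^ i * u) * 2 ^ K + j %% 2 ^ K.
  by rewrite IHk mulnS mulnDl {1}ep; lia.
rewrite {1}ej; apply: par; rewrite oddD oddM ou andbT.
have -> : odd (p ^ i).
  by rewrite oddX; apply/orP; right; move: p8; rewrite {2}(divn_eq p 8); lia.
by move: no; do 2 case: (odd _).
Qed.

End PrimeThreeModEight.

(** * A binomial coefficient prime to p, and uniqueness of x^2 + 2 y^2 = p^n *)

Lemma logn_fact_le p n N : prime p -> n <= N ->
  logn p n`! = \sum_(1 <= k < N.+1) n %/ p ^ k.
Proof.
move=> pp nN; rewrite logn_fact // [RHS](big_cat_nat _ (n := n.+1)) //=.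
rewrite [X in _ = _ + X]big_nat_cond [X in _ = _ + X]big1 ?addn0 // => k.
rewrite andbT => /andP[nk _]; rewrite divn_small //.
by apply: leq_trans nk _; apply/ltnW/ltn_expl/prime_gt1.
Qed.

(** The part a y of t contributes 5a = 3a + 2a, so only the remainder r counts; the bound on 5r says
    that the quotients u of 3r and v of 2r add without carry. *)
Lemma divn_five_split a r t y u v : t = a * y + r ->
  u * y <= 3 * r < u.+1 * y -> v * y <= 2 * r < v.+1 * y ->
  5 * r < (u + v).+1 * y -> 5 * t %/ y = 3 * t %/ y + 2 * t %/ y.
Proof.
move=> ht u3 v2 uv5.
have divE c x : x * y <= c < x.+1 * y -> c %/ y = x.
  move=> /andP[xc cx]; have y0 : 0 < y by case: (y) cx; rewrite ?muln0.
  by apply/eqP; rewrite eqn_leq leq_divRL // xc andbT -ltnS ltn_divLR.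
rewrite (divE _ (5 * a + (u + v))); last by rewrite ht; lia.
rewrite (divE _ (3 * a + u)); last by rewrite ht; lia.
by rewrite (divE _ (2 * a + v)); [lia | rewrite ht; lia].
Qed.

(* No carry occurs when adding 3(q-1)/8 and 2(q-1)/8 in base p. *)
Lemma bin_five_three_eighths p s t : prime p -> p %% 8 = 3 -> ~~ odd s ->
  p ^ s = (8 * t).+1 -> ~~ (p %| 'C(5 * t, 3 * t)).
Proof.
move=> pp p8 es hq.
have p0 := prime_gt0 pp.
(* With y = p^k and k < s, the remainder of t = (q-1)/8 modulo y is (3y-1)/8 for k odd and (y-1)/8
   for k even, because y is 3 or 1 mod 8. For k >= s all quotients are 0. *)
have key k : 1 <= k -> 5 * t %/ p ^ k = 3 * t %/ p ^ k + 2 * t %/ p ^ k.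
  move=> k1; have [sk|ks] := leqP s k.
    have : p ^ s <= p ^ k by rewrite leq_exp2l // prime_gt1.
    by rewrite hq => h; rewrite !divn_small //; lia.
  have e : p ^ (s - k) * p ^ k = (8 * t).+1 by rewrite -expnD subnK // ltnW.
  have /= Y := divn_eq (p ^ k) 8; have /= P := divn_eq (p ^ (s - k)) 8.
  have Y0 : 0 < p ^ k by rewrite expn_gt0 p0.
  have [ok|ek] := boolP (odd k).
    have osk : odd (s - k) by rewrite oddB ?(ltnW ks) // (negPf es) ok.
    rewrite exp_odd_mod8 // in Y; rewrite exp_odd_mod8 // in P.
    set b := p ^ k %/ 8 in Y; set a := p ^ (s - k) %/ 8 in P.
    have ht : t = a * p ^ k + (3 * b + 1) by move: e; rewrite P Y; nia.
    by apply: (divn_five_split (u := 1) (v := 0) ht); lia.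
  have esk : ~~ odd (s - k) by rewrite oddB ?(ltnW ks) // (negPf es) (negPf ek).
  rewrite exp_even_mod8 // in Y; rewrite exp_even_mod8 // in P.
  set b := p ^ k %/ 8 in Y; set a := p ^ (s - k) %/ 8 in P.
  have ht : t = a * p ^ k + b by move: e; rewrite P Y; nia.
  by apply: (divn_five_split (u := 0) (v := 0) ht); lia.
have le : 3 * t <= 5 * t by lia.
have := bin_fact le; rewrite (_ : 5 * t - 3 * t = 2 * t); last by lia.
move=> /(congr1 (logn p)).
have B0 : 0 < 'C(5 * t, 3 * t) by rewrite bin_gt0.
rewrite !lognM ?muln_gt0 ?fact_gt0 //.
rewrite !(logn_fact_le (N := 5 * t)) ?leq_mul2r //; try lia.
rewrite -big_split /= => h.
have : logn p 'C(5 * t, 3 * t) = 0.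
  suff : \sum_(1 <= i < (5 * t).+1) (3 * t %/ p ^ i + 2 * t %/ p ^ i)
    = \sum_(1 <= k < (5 * t).+1) 5 * t %/ p ^ k by lia.
  by apply: eq_big_nat => k /andP[k1 _]; rewrite key.
move=> l0; apply/negP => d; have := d; rewrite -{1}(expn1 p) pfactor_dvdn //.
by rewrite l0.
Qed.

Local Open Scope ring_scope.

(* p^n divides one of ad - bc, ad + bc, whose squares are at most p^(2n) / 2. *)
Lemma sqr_plus_two_sqr_unique (p n : nat) (a b c d : int) :
  prime p -> odd p -> (0 < n)%N ->
  a ^+ 2 + 2 * b ^+ 2 = (p ^ n)%N -> c ^+ 2 + 2 * d ^+ 2 = (p ^ n)%N ->
  ~~ (p %| a)%Z -> ~~ (p %| c)%Z ->
  (c = a \/ c = - a) /\ (d = b \/ d = - b).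
Proof.
move=> pp op n0 ab cd pa pc.
have pn0 : 0 < (p ^ n)%N%:Z by rewrite ltz_nat expn_gt0 prime_gt0.
have cop x : ~~ (p %| x)%Z -> coprimez (p ^ n)%N x.
  by rewrite /coprimez /gcdz !dvdzE /= => h; rewrite eqz_nat; apply/eqP/eqP;
     rewrite -/(coprime _ _) coprime_pexpl ?prime_coprime.
have key : (a * d - b * c) * (a * d + b * c) = (p ^ n)%N%:Z * (d ^+ 2 - b ^+ 2).
  transitivity (a ^+ 2 * d ^+ 2 - b ^+ 2 * c ^+ 2); first by ring.
  by rewrite mulrBr -{1}ab -cd; ring.
(* The bound is Brahmagupta's identity p^(2n) = (ac - 2bd)^2 + 2 (ad + bc)^2, or the same with -b
   for b. A multiple of p^n whose square is at most p^(2n)/2 is 0. *)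
have zero (x y : int) : x = a * d + y ->
   y = b * c \/ y = - (b * c) -> ((p ^ n)%N %| x)%Z -> x = 0.
  move=> xE yE /dvdzP[k xk].
  have : 2 * x ^+ 2 <= (p ^ n)%N%:Z ^+ 2.
    rewrite [X in _ <= X]expr2 -{1}ab -cd xE; case: yE => ->; rewrite -subr_ge0.
      rewrite (_ : _ - _ = (a * c - 2 * b * d) ^+ 2) ?sqr_ge0 //; ring.
    rewrite (_ : _ - _ = (a * c + 2 * b * d) ^+ 2) ?sqr_ge0 //; ring.
  rewrite xk => h; suff -> : k = 0 by rewrite mul0r.
  move: h pn0; set P := (p ^ n)%N%:Z => h P0.
  have h2 : 2 * k ^+ 2 <= 1.
    rewrite -(@ler_pM2r _ (P ^+ 2)) ?exprn_gt0 // mul1r; move: h.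
    by rewrite exprMn mulrA.
  by move: h2; clear; nia.
have dich : ((p ^ n)%N %| a * d - b * c)%Z \/ ((p ^ n)%N %| a * d + b * c)%Z.
  (* p cannot divide both factors of [key]: it would divide 2ad, hence d, hence c. So one factor
     absorbs all of p^n. *)
  have [d1|d1] := boolP (p %| a * d - b * c)%Z.
    have d2 : ~~ (p %| a * d + b * c)%Z.
      apply/negP=> d2; have : (p %| 2 * a * d)%Z.
        by rewrite (_ : 2 * a * d = a * d - b * c + (a * d + b * c)); [exact: rpredD | ring].
      have pd : ~~ (p %| d)%Z.
        apply/negP=> pd; case/negP: pc.
        have : (p %| c ^+ 2)%Z.
          rewrite (_ : c ^+ 2 = (p ^ n)%N%:Z - 2 * d * d); last by rewrite -cd; ring.
          rewrite rpredB ?dvdz_mull //.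
          by rewrite dvdzE /= dvdn_exp.
        by rewrite !dvdzE abszX Euclid_dvdX // andbT.
      move: pa pd; rewrite !dvdzE !abszM !Euclid_dvdM // => /negPf-> /negPf->.
      rewrite /= orbF dvdn_prime2 // orbF => /eqP e2.
      by rewrite e2 in op.
    left; rewrite -(Gauss_dvdzl _ (cop _ d2)) key dvdz_mulr //.
  right; rewrite -(Gauss_dvdzr _ (cop _ d1)) key dvdz_mulr //.
have sq : (a * d) ^+ 2 = (b * c) ^+ 2.
  case: dich => [h|h].
    have := zero _ _ (erefl _) (or_intror erefl) h => e.
    by have /eqP -> : a * d == b * c by rewrite -subr_eq0 e.
  have := zero _ _ (erefl _) (or_introl erefl) h => e.
  have /eqP -> : a * d == - (b * c) by rewrite -addr_eq0 e.
  by rewrite sqrrN.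
have a2 : c ^+ 2 = a ^+ 2.
  apply: (mulIf (lt0r_neq0 pn0)); rewrite -{1}ab -cd.
  by move: sq; rewrite !exprMn; clear; lia.
have d2 : d ^+ 2 = b ^+ 2 by move: cd; rewrite -ab a2; clear; lia.
by split; [have /eqP := a2|have /eqP := d2]; rewrite eqf_sqr => /orP[]/eqP; auto.
Qed.

(** * Gauss and Jacobi sums *)

(** Even the trivial character vanishes at 0, so its Gauss sum is -1 and not 0. *)
Definition mult_char (K : finFieldType) (chi : K -> algC) :=
  [/\ chi 0 = 0, chi 1 = 1 & {morph chi : x y / x * y}].

Definition nontrivial_mult (K : finFieldType) (chi : K -> algC) :=
  exists2 x, x != 0 & chi x != 1.

Definition add_char (K : finFieldType) (psi : K -> algC) :=
  [/\ psi 0 = 1, {morph psi : x y / x + y >-> x * y},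
      (forall x, psi (- x) = (psi x)^* ) & exists x, psi x != 1].

Definition gauss (K : finFieldType) (chi psi : K -> algC) : algC :=
  \sum_x chi x * psi x.

Definition jacobi (K : finFieldType) (chi phi : K -> algC) : algC :=
  \sum_x chi x * phi (1 - x).

Section GaussSums.
Variable K : finFieldType.
Implicit Types (chi phi psi : K -> algC) (a x y : K).

Lemma mult_charX chi x n : mult_char chi -> chi (x ^+ n) = chi x ^+ n.
Proof.
move=> [_ c1 cM]; elim: n => [|n IHn]; first by rewrite !expr0.
by rewrite !exprS cM IHn.
Qed.

Lemma mult_char_neq0 chi x : mult_char chi -> x != 0 -> chi x != 0.
Proof.
move=> [_ c1 cM] x0; apply/eqP=> cx0.
have := cM x x^-1; rewrite cx0 mul0r divff // c1 => /eqP.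
by rewrite oner_eq0.
Qed.

Lemma finField_expf_pred x : x != 0 -> x ^+ #|K|.-1 = 1.
Proof.
move=> x0; apply: (mulfI x0); rewrite -exprS prednK ?expf_card ?mulr1 //.
by apply/card_gt0P; exists 0.
Qed.

Lemma mult_char_norm chi x :
  mult_char chi -> x != 0 -> chi x * (chi x)^* = 1.
Proof.
move=> cP x0; have := mult_charX x #|K|.-1 cP.
rewrite finField_expf_pred //; case: (cP) => _ -> _ /esym c1.
have q0 : (0 < #|K|.-1)%N.
  by rewrite -subn1 subn_gt0 finNzRing_gt1.
have nx : `|chi x| = 1.
  apply/eqP; rewrite -(@pexpr_eq1 _ _ #|K|.-1) //.
  by rewrite -normrX c1 normr1.
by rewrite -normCK nx expr1n.
Qed.

Lemma mult_charM chi phi :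
  mult_char chi -> mult_char phi -> mult_char (fun x => chi x * phi x).
Proof.
move=> [c0 c1 cM] [p0 p1 pM]; split; rewrite ?c0 ?c1 ?p1 ?mul0r ?mul1r //.
by move=> x y; rewrite cM pM mulrACA.
Qed.

Lemma sum_mult_char chi :
  mult_char chi -> nontrivial_mult chi -> \sum_x chi x = 0.
Proof.
move=> [c0 c1 cM] [a a0 ca].
have h : chi a * (\sum_x chi x) = \sum_x chi x.
  rewrite mulr_sumr [RHS](reindex_inj (mulfI a0)).
  by apply: eq_bigr => x _; rewrite cM.
apply/eqP; have : (chi a - 1) * (\sum_x chi x) == 0.
  by rewrite mulrBl h mul1r subrr.
by rewrite mulf_eq0 subr_eq0 (negPf ca).
Qed.

Lemma sum_add_char psi : add_char psi -> \sum_x psi x = 0.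
Proof.
move=> [_ pD _ [a pa]].
have h : psi a * (\sum_x psi x) = \sum_x psi x.
  rewrite mulr_sumr [RHS](reindex_inj (addrI a)).
  by apply: eq_bigr => x _; rewrite pD.
apply/eqP; have : (psi a - 1) * (\sum_x psi x) == 0.
  by rewrite mulrBl h mul1r subrr.
by rewrite mulf_eq0 subr_eq0 (negPf pa).
Qed.

Lemma sum_add_charM psi a :
  add_char psi -> \sum_x psi (a * x) = if a == 0 then #|K|%:R else 0.
Proof.
move=> pP; case: eqP => [->|/eqP a0].
  rewrite (eq_bigr (fun=> 1)) => [|x _]; first by rewrite sumr_const.
  by rewrite mul0r; case: pP.
by rewrite -[RHS](sum_add_char pP) [RHS](reindex_inj (mulfI a0)).
Qed.

Lemma gauss_twist chi psi a : mult_char chi -> add_char psi -> a != 0 ->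
  \sum_x chi x * psi (a * x) = (chi a)^* * gauss chi psi.
Proof.
move=> cP pP a0; rewrite /gauss mulr_sumr [RHS](reindex_inj (mulfI a0)).
apply: eq_bigr => x _; case: (cP) => _ _ cM.
by rewrite cM !mulrA [_^* * _]mulrC mult_char_norm // mul1r.
Qed.

Lemma gauss_conj chi psi : mult_char chi -> add_char psi ->
  (gauss chi psi)^* = chi (-1) * gauss (fun x => (chi x)^* ) psi.
Proof.
move=> cP [_ _ pN _]; have N1 : (-1 : K) != 0 by rewrite oppr_eq0 oner_eq0.
rewrite /gauss rmorph_sum mulr_sumr (reindex_inj oppr_inj) /=.
apply: eq_bigr => x _; case: (cP) => _ _ cM.
have -> : chi (- x) = chi (-1) * chi x by rewrite -cM mulN1r.
rewrite !rmorphM /= -pN opprK mulrA.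
congr (_ * _ * _); have : chi (-1) ^+ 2 = 1.
  by rewrite -mult_charX // sqrrN expr1n; case: cP.
move=> c2; apply: (mulfI (mult_char_neq0 cP N1)).
by rewrite mult_char_norm // -expr2.
Qed.

(** Double counting of the squared modulus of the twisted sums over all a: each a != 0 gives |G|^2
    and a = 0 gives 0, while after expansion orthogonality of [psi] leaves only the diagonal x =
    y. *)
Lemma gauss_norm chi psi : mult_char chi -> nontrivial_mult chi ->
  add_char psi -> gauss chi psi * (gauss chi psi)^* = #|K|%:R.
Proof.
move=> cP cn pP; set G := gauss chi psi.
have e1 : \sum_a (\sum_x chi x * psi (a * x)) * (\sum_y chi y * psi (a * y))^*
        = (#|K|.-1)%:R * (G * G^* ).
  rewrite (bigD1 0) //=.
  have -> : \sum_x chi x * psi (0 * x) = 0.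
    rewrite -[RHS](sum_mult_char cP cn); apply: eq_bigr => x _.
    by rewrite mul0r; case: pP => -> _ _ _; rewrite mulr1.
  rewrite mul0r add0r (eq_bigr (fun=> G * G^* )) => [|a a0].
    by rewrite sumr_const cardC1 mulr_natl.
  rewrite gauss_twist // rmorphM /= conjCK mulrACA [_^* * _]mulrC.
  by rewrite mult_char_norm // mul1r.
have e2 : \sum_a (\sum_x chi x * psi (a * x)) * (\sum_y chi y * psi (a * y))^*
        = #|K|%:R * (#|K|.-1)%:R.
  transitivity (\sum_x \sum_y chi x * (chi y)^* * \sum_a psi ((x - y) * a)).
    transitivity (\sum_a \sum_x \sum_y chi x * (chi y)^* * psi ((x - y) * a)).
      apply: eq_bigr => a _; rewrite rmorph_sum mulr_suml; apply: eq_bigr => x _.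
      rewrite mulr_sumr; apply: eq_bigr => y _.
      case: pP => _ pD pN _.
      by rewrite rmorphM /= -pN mulrACA -pD -mulrN -mulrDr [a * _]mulrC.
    rewrite exchange_big; apply: eq_bigr => x _; rewrite exchange_big.
    by apply: eq_bigr => y _; rewrite mulr_sumr.
  transitivity (\sum_x chi x * (chi x)^* * #|K|%:R).
    apply: eq_bigr => x _; rewrite (bigD1 x) //= subrr sum_add_charM // eqxx.
    rewrite big1 ?addr0 // => y yx; rewrite sum_add_charM // subr_eq0 eq_sym.
    by rewrite (negPf yx) mulr0.
  rewrite -mulr_suml mulrC; congr (_ * _); rewrite (bigD1 0) //=.
  case: (cP) => -> _ _; rewrite mul0r add0r (eq_bigr (fun=> 1)).
    by rewrite sumr_const cardC1.
  by move=> x x0; rewrite mult_char_norm.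
have q0 : (#|K|.-1)%:R != 0 :> algC.
  by rewrite pnatr_eq0 -lt0n -subn1 subn_gt0 finNzRing_gt1.
by apply: (mulfI q0); rewrite -e1 e2 mulrC.
Qed.

Lemma gauss_neq0 chi psi : mult_char chi -> nontrivial_mult chi ->
  add_char psi -> gauss chi psi != 0.
Proof.
move=> cP cn pP; apply/eqP=> G0; have := gauss_norm cP cn pP.
rewrite G0 mul0r => /esym/eqP; rewrite pnatr_eq0 => /eqP.
by have := finNzRing_gt1 K; case: #|K|.
Qed.

(** Collecting terms by t = x + y turns the product into a convolution. Scaling by t != 0 extracts
    the Jacobi sum; t = 0 gives the full sum of chi phi, which is 0. *)
Lemma jacobi_gauss chi phi psi : mult_char chi -> mult_char phi ->
  nontrivial_mult (fun x => chi x * phi x) -> add_char psi ->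
  gauss chi psi * gauss phi psi
  = jacobi chi phi * gauss (fun x => chi x * phi x) psi.
Proof.
move=> cP pP cpn sP.
case: (cP) => c0 c1 cM; case: (pP) => p0 p1 pM; case: (sP) => s0 sD sN _.
transitivity (\sum_t psi t * \sum_x chi x * phi (t - x)).
  transitivity (\sum_x \sum_t chi x * phi (t - x) * psi t); last first.
    rewrite exchange_big; apply: eq_bigr => t _; rewrite mulr_sumr.
    by apply: eq_bigr => x _; rewrite mulrC.
  rewrite /gauss mulr_suml; apply: eq_bigr => x _; rewrite mulr_sumr.
  rewrite (reindex_inj (addIr (- x))); apply: eq_bigr => y _.
  by rewrite mulrACA -sD [x + _]addrC subrK.
rewrite /gauss mulr_sumr; apply: eq_bigr => t _.
have [->|t0] := eqVneq t 0; last first.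
  rewrite [RHS]mulrA [RHS]mulrC; congr (_ * _).
  rewrite (reindex_inj (mulfI t0)) /jacobi mulr_suml; apply: eq_bigr => x _.
  have -> : t - t * x = t * (1 - x) by rewrite mulrBr mulr1.
  by rewrite cM pM mulrACA [RHS]mulrC.
rewrite c0 !mul0r mulr0 s0 mul1r.
transitivity (phi (-1) * \sum_x chi x * phi x).
  rewrite mulr_sumr; apply: eq_bigr => x _.
  by rewrite sub0r -(mulN1r x) pM mulrCA.
by rewrite (sum_mult_char (mult_charM cP pP) cpn) mulr0.
Qed.

(* The substitution x = (1 + t) / 2 turns x (1 - x) into (1 - t^2) / 4. *)
Lemma jacobi_self chi eta : mult_char chi -> mult_char eta ->
  nontrivial_mult chi ->
  2%:R != 0 :> K ->
  (forall y, #|[set t : K | t ^+ 2 == y]|%:R = 1 + eta y) ->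
  jacobi chi chi = (chi 4%:R)^* * jacobi chi eta.
Proof.
move=> cP eP cn two0 etaE; case: (cP) => c0 c1 cM.
have four0 : 4%:R != 0 :> K by rewrite (_ : 4%:R = 2%:R * 2%:R) ?mulf_neq0 // -natrM.
transitivity ((chi 4%:R)^* * \sum_t chi (1 - t ^+ 2)).
  rewrite /jacobi mulr_sumr.
  have inj : injective (fun t : K => (1 + t) / 2%:R).
    by move=> t u /= /(mulIf (invr_neq0 two0)) /addrI.
  rewrite (reindex_inj inj) /=; apply: eq_bigr => t _.
  have e : 1 - t ^+ 2 = 4%:R * ((1 + t) / 2%:R * (1 - (1 + t) / 2%:R)).
    by field.
  by rewrite e !cM !mulrA [_^* * _]mulrC mult_char_norm // mul1r.
congr (_ * _).
(* Each y = t^2 occurs 1 + eta y times; the summand 1 contributes the full sum of chi, which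
   vanishes. *)
transitivity (\sum_y chi (1 - y) * (1 + eta y)).
  rewrite (partition_big (fun t : K => t ^+ 2) predT) //=.
  apply: eq_bigr => y _; rewrite -etaE -sum1dep_card natr_sum mulr_sumr.
  by apply: eq_big => [t|t /eqP->]; rewrite ?inE ?mulr1.
rewrite /jacobi [RHS](reindex_inj (subrI 1)) /=.
under eq_bigr do rewrite mulrDr mulr1.
rewrite big_split /= -[RHS]add0r; congr (_ + _).
  rewrite -[RHS](sum_mult_char cP cn) [RHS](reindex_inj (subrI 1)).
  by apply: eq_bigr.
by apply: eq_bigr => y _; rewrite subKr.
Qed.

(* The case of two factors of the Hasse-Davenport product formula. *)
Lemma gauss_double chi eta psi : mult_char chi -> mult_char eta ->
  nontrivial_mult chi -> nontrivial_mult (fun x => chi x * chi x) ->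
  nontrivial_mult (fun x => chi x * eta x) -> add_char psi ->
  2%:R != 0 :> K ->
  (forall y, #|[set t : K | t ^+ 2 == y]|%:R = 1 + eta y) ->
  gauss chi psi * gauss (fun x => chi x * eta x) psi
  = (chi 4%:R)^* * (gauss (fun x => chi x * chi x) psi * gauss eta psi).
Proof.
move=> cP eP cn ccn cen pP two0 etaE.
have j1 := jacobi_gauss cP cP ccn pP.
have j2 := jacobi_gauss cP eP cen pP.
rewrite (jacobi_self cP eP cn two0 etaE) in j1.
(* After multiplication by G(chi), [j1] on the left and [j2] on the right produce the same J(chi,
   eta). *)
apply: (mulfI (gauss_neq0 cP cn pP)).
rewrite mulrA j1 !mulrA.
rewrite -[RHS]mulrA [gauss chi psi * _]mulrC -[RHS]mulrA.
rewrite -!mulrA [gauss chi psi * (_ * _)]mulrCA j2.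
by rewrite !mulrA; congr (_ * _); rewrite mulrAC.
Qed.

End GaussSums.

(** * Sums stable under Frobenius *)

Definition residue_count (I : finType) (P : pred I) (e : I -> nat) (j : nat) :=
  #|[pred i | P i && (e i %% 8 == j)%N]|.

(** The ring is arbitrary so that the same integers describe the Jacobi sum in algC and its
    reduction in F, with an eighth root of unity of F for [v]. *)
Lemma sum_eighth_root (K : comNzRingType) (I : finType) (P : pred I)
    (e : I -> nat) (v : K) (c := residue_count P e) :
  v ^+ 4 = -1 -> c 1%N = c 3%N -> c 2%N = c 6%N -> c 5%N = c 7%N ->
  \sum_(i | P i) v ^+ e i
  = ((c 0%N)%:Z - (c 4%N)%:Z)%:~R + ((c 1%N)%:Z - (c 5%N)%:Z)%:~R * (v + v ^+ 3).
Proof.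
move=> v4 c13 c26 c57.
have v8 : v ^+ 8 = 1 by rewrite (exprM v 4 2) v4 sqrrN expr1n.
transitivity (\sum_(j < 8) v ^+ j *+ c j).
  rewrite (partition_big (fun i => inord (e i %% 8) : 'I_8) predT) //=.
  apply: eq_bigr => j _.
  rewrite (eq_bigr (fun=> v ^+ j)) => [|i /andP[_ /eqP<-]]; last first.
    rewrite inordK ?ltn_mod // {1}(divn_eq (e i) 8) exprD mulnC exprM v8.
    by rewrite expr1n mul1r.
  rewrite sumr_const; congr (_ *+ _); apply: eq_card => i; rewrite !inE.
  congr (_ && _); rewrite -val_eqE /= inordK ?ltn_mod //.
rewrite !big_ord_recl big_ord0 /= /bump /= addr0.
rewrite !addn0 !add1n -c13 -c26 -c57.
have -> : v ^+ 7 = - v ^+ 3 by rewrite (exprD v 4 3) v4 mulN1r.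
have -> : v ^+ 6 = - v ^+ 2 by rewrite (exprD v 4 2) v4 mulN1r.
have -> : v ^+ 5 = - v by rewrite (exprD v 4 1) v4 mulN1r.
rewrite v4 !rmorphB /= -!pmulrn.
by move: (c 0%N) (c 1%N) (c 2%N) (c 4%N) (c 5%N) => *; ring.
Qed.

Section FrobeniusStable.
Variables (p : nat) (p8 : (p %% 8 = 3)%N) (I : finType) (sigma : I -> I).
Hypothesis sigma_inj : injective sigma.

Definition frob_stable (P : pred I) (e : I -> nat) (r : nat) :=
  (forall i, P (sigma i) = P i) /\
  (forall i, P i -> e (sigma i) = p * e i %[mod 2 ^ r])%N.

(** [sigma] maps the class j injectively into the class 3j, since p = 3 mod 8. As 9 = 1 mod 8, the
    inequality in both directions pairs 1 with 3, 2 with 6 and 5 with 7. *)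
Lemma frob_residue_count P e r j k : frob_stable P e r.+3 ->
  (k = 3 * j %[mod 8])%N -> (j < 8)%N -> (k < 8)%N ->
  (residue_count P e j <= residue_count P e k)%N.
Proof.
move=> [Ps es] kj j8 k8; rewrite /residue_count -(card_image sigma_inj).
apply/subset_leq_card/subsetP => y /imageP[i]; rewrite !inE => /andP[Pi /eqP ei] -> {y}.
rewrite Ps Pi /=; apply/eqP; rewrite -(modn_small k8) kj.
have e8 : e (sigma i) = p * e i %[mod 8].
  have h := es i Pi; rewrite -(@modn_dvdm (2 ^ r.+3) _ 8) ?(dvdn_exp2l 2 (m := 3)) //.
  by rewrite h modn_dvdm // (dvdn_exp2l 2 (m := 3)).
by rewrite e8 -modnMm p8 ei.
Qed.

Lemma frob_stable_counts P e r (c := residue_count P e) : frob_stable P e r.+3 ->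
  [/\ c 1%N = c 3%N, c 2%N = c 6%N & c 5%N = c 7%N].
Proof.
by move=> st; split; apply/eqP; rewrite eqn_leq;
   rewrite !(frob_residue_count st).
Qed.

(** In the induction step the terms with odd exponent cancel: applying [sigma] 2^(r+1) times
    multiplies the exponent by p^(2^(r+1)), which is 1 plus half the order of z, and so changes the
    sign of the term. The even exponents are halved, z being replaced by z^2, until order 8 is
    reached. *)
Lemma frob_stable_sum r P e (z : algC) : frob_stable P e r.+3 ->
  z ^+ (2 ^ r.+2) = -1 ->
  exists a b : int, \sum_(i | P i) z ^+ e i
    = a%:~R + b%:~R * (z ^+ (2 ^ r) + z ^+ (2 ^ r) ^+ 3).
Proof.
elim: r P e z => [|r IHr] P e z st zr.
  have [c1 c2 c3] := frob_stable_counts st.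
  rewrite expn0 expr1; do 2 eexists; apply: sum_eighth_root => //.
have [Ps es] := st.
have z4 : z ^+ (2 ^ r.+4) = 1 by rewrite expnSr exprM zr sqrrN expr1n.
have op : odd p by move: p8; rewrite {2}(divn_eq p 8); lia.
have par i : P i -> odd (e (sigma i)) = odd (e i).
  move=> Pi; have h := es i Pi; move/(congr1 odd): h.
  by rewrite !odd_mod ?oddX // oddM op.
rewrite (bigID (fun i => odd (e i))) /=.
have -> : \sum_(i | P i && odd (e i)) z ^+ e i = 0.
  have [u ou hu] := exp_two_pow_step p8 r.
  have it n i : P (iter n sigma i) = P i /\
     (P i -> e (iter n sigma i) = p ^ n * e i %[mod 2 ^ r.+4] /\
        odd (e (iter n sigma i)) = odd (e i))%N.
    elim: n => [|n [IH1 IH2]]; first by rewrite mul1n.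
    rewrite iterS Ps IH1; split=> // Pi; have [h1 h2] := IH2 Pi.
    have Pj : P (iter n sigma i) by rewrite IH1.
    by rewrite par // h2; split=> //; rewrite es // -modnMmr h1 modnMmr (expnS p) mulnA.
  pose tau := iter (2 ^ r.+1) sigma.
  have tau_inj : injective tau.
    by rewrite /tau; elim: (2 ^ r.+1)%N => [|n IHn] // x y /sigma_inj /IHn.
  set S := \sum_(i | _) _; suff : S = - S.
    move=> h; have /eqP : S *+ 2 = 0 by rewrite mulr2n {2}h subrr.
    by rewrite mulrn_eq0 => /eqP.
  rewrite {1}/S (reindex_inj tau_inj) /= -sumrN.
  have eqP0 i : P (tau i) && odd (e (tau i)) = P i && odd (e i).
    have [h1 h2] := it (2 ^ r.+1)%N i; rewrite /tau h1; case Pi : (P i) => //=.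
    by have [_ ->] := h2 Pi.
  apply: eq_big => [//|i]; rewrite eqP0 => /andP[Pi oi].
  have [_ h2] := it (2 ^ r.+1)%N i; have [h3 _] := h2 Pi.
  rewrite -(expr_mod _ z4) h3 (expr_mod _ z4) hu mulSn exprD.
  rewrite mulnAC mulnC exprM zr -signr_odd oddM ou oi expr1.
  by rewrite mulrN1.
rewrite add0r.
have st' : frob_stable (fun i => P i && ~~ odd (e i)) (fun i => (e i)./2) r.+3.
  split=> [i|i /andP[Pi ei]].
    by rewrite Ps; case Pi : (P i) => //=; rewrite par.
  have h := es i Pi; have e1 : ~~ odd (e (sigma i)) by rewrite par.
  apply/eqP; rewrite -(@eqn_pmul2l 2) // !muln_modr -!expnS mul2n even_halfK //.
  by rewrite mulnCA mul2n even_halfK // h.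
have zr' : (z ^+ 2) ^+ (2 ^ r.+2) = -1 by rewrite -exprM -expnS.
have [a [b ab]] := IHr _ _ _ st' zr'.
exists a, b; rewrite expnS exprM -ab; apply: eq_bigr => i /andP[_ ei].
by rewrite -exprM mul2n even_halfK.
Qed.

End FrobeniusStable.

(** * The trace and the discrete logarithm *)

(** Defined through representatives; it is compatible with the ring operations only because F has
    characteristic p, which is proved below. *)
Definition prime_emb (F : finFieldType) (p : nat) (c : 'F_p) : F := (c : nat)%:R.

Section Trace.
Variables (F : finFieldType) (p s : nat).
Hypotheses (p_pr : prime p) (cardF : #|F| = (p ^ s)%N).

(** Translation by 1 permutes F, so comparing the sums of all elements gives q = 0 in F, whence p =
    0. *)
Lemma finField_pchar : p \in [pchar F].
Proof.
have q0 : #|F|%:R = 0 :> F.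
  have : \sum_(x : F) x = \sum_(x : F) (x + 1).
    by rewrite [LHS](reindex_inj (addIr 1)).
  rewrite big_split /= sumr_const -{1}[LHS]addr0 => /addrI/esym.
  by rewrite cardT -cardE.
rewrite inE p_pr /=; move: q0; rewrite cardF natrX => /eqP.
by rewrite expf_eq0 => /andP[].
Qed.

Let pchF := finField_pchar.

Lemma frobeniusD (x y : F) i : (x + y) ^+ (p ^ i) = x ^+ (p ^ i) + y ^+ (p ^ i).
Proof. by rewrite exprDn_pchar // pnatX pnatE // pchF. Qed.

Lemma prime_emb_natr n : prime_emb F (n%:R : 'F_p) = n%:R.
Proof. by rewrite /prime_emb val_Fp_nat // GRing.natr_mod_pchar. Qed.

Lemma prime_embK (c : 'F_p) : (c : nat)%:R = c.
Proof. exact: natr_Zp. Qed.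

Lemma prime_embD : {morph @prime_emb F p : c d / c + d}.
Proof.
move=> c d; rewrite -{1}(prime_embK c) -{1}(prime_embK d) -natrD.
by rewrite prime_emb_natr natrD.
Qed.

Lemma prime_embM : {morph @prime_emb F p : c d / c * d}.
Proof.
move=> c d; rewrite -{1}(prime_embK c) -{1}(prime_embK d) -natrM.
by rewrite prime_emb_natr natrM.
Qed.

Lemma prime_emb_eq0 c : (prime_emb F c == 0) = (c == 0 :> 'F_p).
Proof.
rewrite /prime_emb -(dvdn_pcharf pchF) -{2}(prime_embK c).
by rewrite -(dvdn_pcharf (pchar_Fp p_pr)).
Qed.

Lemma prime_emb_inj : injective (@prime_emb F p).
Proof.
move=> c d e; apply/eqP; rewrite -subr_eq0 -prime_emb_eq0.
have := prime_embD (c - d) d; rewrite subrK -e => /eqP.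
by rewrite eq_sym -subr_eq0 addrK.
Qed.

Lemma prime_emb_frob (c : 'F_p) i : prime_emb F c ^+ (p ^ i) = prime_emb F c.
Proof.
elim: i => [|i IHi]; first by rewrite expr1.
rewrite expnSr exprM IHi /prime_emb -natrX.
by rewrite -(GRing.natr_mod_pchar pchF (_ ^ p)) fermat_little // GRing.natr_mod_pchar.
Qed.

(** The p embedded elements already exhaust the roots of X^p - X. *)
Lemma prime_emb_range (x : F) : x ^+ p = x -> exists c : 'F_p, prime_emb F c = x.
Proof.
move=> xp; pose rs := [seq prime_emb F c | c : 'F_p].
have urs : uniq rs by rewrite map_inj_uniq ?enum_uniq //; exact: prime_emb_inj.
have srs : size rs = p by rewrite size_map -cardE card_Fp.
have [/imageP[c _ ->]|xrs] := boolP (x \in rs); first by exists c.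
pose f : {poly F} := 'X^p - 'X.
have p1 := prime_gt1 p_pr.
have sf : size f = p.+1.
  by rewrite size_polyDl ?size_polyXn // size_polyN size_polyX ltnS.
have f0 : f != 0 by rewrite -size_poly_eq0 sf.
have := @max_poly_roots _ f (x :: rs) f0.
rewrite sf /= srs ltnn xrs urs => h; suff : false by []; apply: h => //.
apply/andP; split; first by rewrite rootE !hornerE xp subrr.
apply/allP => y /imageP[c _ ->]; rewrite rootE !hornerE.
by have := prime_emb_frob c 1; rewrite expn1 => ->; rewrite subrr.
Qed.

Definition trace_sum (x : F) : F := \sum_(i < s) x ^+ (p ^ i).

Lemma frobenius_sum n (f : 'I_n -> F) : (\sum_i f i) ^+ p = \sum_i f i ^+ p.
Proof.
apply: (big_morph (fun y : F => y ^+ p)) => [u v|].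
  by have := frobeniusD u v 1; rewrite expn1.
by rewrite expr0n; case: (p) p_pr.
Qed.

Lemma trace_sum_frob x : trace_sum x ^+ p = trace_sum x.
Proof.
rewrite /trace_sum frobenius_sum.
under eq_bigr do rewrite -exprM -expnSr.
case: s cardF => [|s'] cF; first by rewrite !big_ord0.
rewrite big_ord_recr big_ord_recl /= -cF expf_card expr1 addrC.
by congr (_ + _).
Qed.

(** The sum of the conjugates is fixed by Frobenius, hence lies in the prime field. It is not
    identically 0, being a nonzero polynomial of degree below q; scaling then reaches the value
    1. *)
Lemma finField_trace : exists tr : F -> 'F_p,
  [/\ {morph tr : x y / x + y},
      forall x, tr (x ^+ p) = tr x,
      forall (c : 'F_p) x, tr (prime_emb F c * x) = c * tr x
    & exists x, tr x = 1].
Proof.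
have ex x : exists c : 'F_p, prime_emb F c == trace_sum x.
  by have [c <-] := prime_emb_range (trace_sum_frob x); exists c.
pose tr x := xchoose (ex x).
have trE x : prime_emb F (tr x) = trace_sum x by apply/eqP/(xchooseP (ex x)).
have trM (c : 'F_p) x : tr (prime_emb F c * x) = c * tr x.
  apply: prime_emb_inj; rewrite prime_embM !trE /trace_sum mulr_sumr.
  by apply: eq_bigr => i _; rewrite exprMn prime_emb_frob.
exists tr; split=> //.
- move=> x y; apply: prime_emb_inj; rewrite prime_embD !trE /trace_sum -big_split.
  by apply: eq_bigr => i _; rewrite frobeniusD.
- move=> x; apply: prime_emb_inj; rewrite !trE -[RHS]trace_sum_frob.
  rewrite /trace_sum frobenius_sum.
  by apply: eq_bigr => i _; rewrite -!exprM mulnC.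
have [x tx] : exists x, tr x != 0.
  apply/existsP; apply: contraT => /existsPn h.
  have {}h x : trace_sum x = 0.
    by have /negPn/eqP t0 := h x; rewrite -trE t0.
  pose f : {poly F} := \sum_(i < s) 'X^(p ^ i).
  have s0 : (0 < s)%N.
    by case: (s) cardF => // e; have := finNzRing_gt1 F; rewrite e.
  have p1 := prime_gt1 p_pr.
  have f0 : f != 0.
    apply/eqP => /(congr1 (fun f : {poly F} => f`_1)); rewrite coef0 /f coef_sum.
    rewrite (bigD1 (Ordinal s0)) //= coefXn eqxx big1 ?addr0; last first.
      move=> i i0; rewrite coefXn; case: eqP => // /esym/eqP.
      rewrite -{1}(expn0 p) eqn_exp2l // => /eqP e; case/eqP: i0.
      exact: val_inj.
    by move/eqP; rewrite oner_eq0.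
  have := @max_poly_roots _ f (enum F) f0.
  have sf : (size f <= #|F|)%N.
    rewrite cardF; apply: leq_trans (size_sum _ _ _) _.
    apply/bigmax_leqP => i _; rewrite size_polyXn.
    by rewrite ltn_exp2l.
  rewrite enum_uniq -cardE ltnNge sf => {}f0; suff : false by []; apply: f0 => //.
  apply/allP => x _; rewrite rootE /f horner_sum -[X in _ == X](h x).
  by apply/eqP/eq_bigr => i _; rewrite hornerXn.
by exists (prime_emb F (tr x)^-1 * x); rewrite trM mulVf.
Qed.

End Trace.

Lemma odd_two_pow_order1 (K : nzRingType) (x : K) a k :
  odd a -> x ^+ a = 1 -> x ^+ (2 ^ k) = 1 -> x = 1.
Proof.
move=> oa xa; elim: k => [|k IHk]; first by rewrite expr1.
rewrite expnSr exprM => x2; apply: IHk.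
set y := x ^+ _ in x2 *.
have : y ^+ a = 1 by rewrite /y -exprM mulnC exprM xa expr1n.
by rewrite -(odd_double_half a) oa add1n -mul2n exprS exprM x2 expr1n mulr1.
Qed.

Lemma finField_generator (F : finFieldType) :
  exists g : F, (#|F|.-1).-primitive_root g.
Proof.
have q0 : (0 < #|F|.-1)%N by rewrite -subn1 subn_gt0 finNzRing_gt1.
have := @cyclic.has_prim_root F _ (enum [pred x : F | x != 0]) q0.
rewrite enum_uniq -cardE cardC1 leqnn => /(_ _ isT isT) h.
have /hasP[g _ gP] : has (#|F|.-1).-primitive_root (enum [pred x : F | x != 0]).
  apply: h; apply/allP => x; rewrite mem_enum inE => x0.
  by apply/unity_rootP/finField_expf_pred.
by exists g.
Qed.

Section DLog.
Variables (F : finFieldType) (g : F).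
Hypothesis gP : (#|F|.-1).-primitive_root g.

(** At 0 the value is the default 0. Elsewhere the identities for [dlog] hold only modulo q - 1,
    which suffices as it is used in exponents of roots of unity of order dividing q - 1. *)
Definition dlog (x : F) : nat :=
  if [pick i : 'I_#|F|.-1 | x == g ^+ i] is Some i then i else 0%N.

Lemma dlogK x : x != 0 -> g ^+ dlog x = x.
Proof.
move=> x0; rewrite /dlog; case: pickP => [i /eqP -> //|no].
have [i xi] := prim_rootP gP (finField_expf_pred x0).
by have := no i; rewrite xi eqxx.
Qed.

Lemma generator_neq0 : g != 0.
Proof.
apply/eqP => g0; have := prim_expr_order gP; rewrite g0 expr0n.
by have := prim_order_gt0 gP; case: #|F|.-1 => //= n _ /esym/eqP; rewrite oner_eq0.
Qed.

Lemma generatorX_neq0 i : g ^+ i != 0.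
Proof. exact/expf_neq0/generator_neq0. Qed.

Lemma dlog_gen i : dlog (g ^+ i) = i %[mod #|F|.-1].
Proof. by apply/eqP; rewrite -(eq_prim_root_expr gP) dlogK ?generatorX_neq0. Qed.

Lemma dlogX x n : x != 0 -> dlog (x ^+ n) = n * dlog x %[mod #|F|.-1].
Proof. by move=> x0; rewrite -{1}(dlogK x0) -exprM mulnC; exact: dlog_gen. Qed.

Lemma sum_nonzero_gen (V : nmodType) (f : F -> V) :
  \sum_(x | x != 0) f x = \sum_(i < #|F|.-1) f (g ^+ i).
Proof.
pose h (i : 'I_#|F|.-1) := g ^+ i.
have q0 := prim_order_gt0 gP.
rewrite (reindex_onto h (fun x => Ordinal (ltn_pmod (dlog x) q0))) /=.
  apply: eq_bigl => i; rewrite /h generatorX_neq0 /=; apply/eqP/val_inj => /=.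
  by rewrite dlog_gen modn_small.
by move=> x x0; rewrite /h /= prim_expr_mod ?dlogK.
Qed.

End DLog.

(** * Reindexing of finite sums *)

Section NatSums.
Variable V : nmodType.
Implicit Type f : nat -> V.

Lemma sum_double f n :
  \sum_(i < 2 * n) f i = \sum_(i < n) f (2 * i)%N + \sum_(i < n) f (2 * i).+1.
Proof.
elim: n => [|n IHn]; first by rewrite muln0 !big_ord0 addr0.
rewrite mulnS !add2n !big_ord_recr /= IHn -!addrA; congr (_ + _).
by rewrite addrCA.
Qed.

Lemma sum_periodic f L d : (forall i, f (i + L)%N = f i) ->
  \sum_(i < d * L) f i = (\sum_(i < L) f i) *+ d.
Proof.
move=> fL; elim: d => [|d IHd]; first by rewrite mul0n big_ord0.
rewrite mulSn big_split_ord /= mulrS -IHd; congr (_ + _).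
by apply: eq_bigr => i _; rewrite addnC fL.
Qed.

Lemma sum_multiples f L d : (0 < d)%N ->
  \sum_(i < L * d | (d %| i)%N) f i = \sum_(i < L) f (i * d)%N.
Proof.
move=> d0; elim: L => [|L IHL]; first by rewrite mul0n !big_ord0.
rewrite mulSn addnC big_mkcond big_split_ord -big_mkcond /= IHL big_ord_recr /=.
congr (_ + _); case: d d0 {IHL} => // d _; rewrite big_ord_recl /= addn0 dvdn_mull //.
rewrite big1 ?addr0 // => i _; rewrite /bump /= dvdn_addr ?dvdn_mull //.
by rewrite gtnNdvd // add1n ltnS.
Qed.

(** Every nonzero k below 2^m is 2^t times an odd number; the exponential sum at g^k is governed by
    t. *)
Lemma sum_by_two_adic_valuation f m :
  \sum_(k < 2 ^ m) f k
  = f 0%N + \sum_(t < m) \sum_(i < 2 ^ (m - t.+1)) f (2 ^ t * (2 * i).+1)%N.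
Proof.
elim: m f => [|m IHm] f; first by rewrite big_ord1 big_ord0 addr0.
rewrite expnS sum_double (IHm (fun k => f (2 * k)%N)) muln0 big_ord_recl -addrA.
congr (_ + _); rewrite addrC expn0 subSS subn0; congr (_ + _).
  by apply: eq_bigr => i _; rewrite mul1n.
apply: eq_bigr => t _; rewrite lift0 subSS; apply: eq_bigr => i _.
by rewrite mulnA -expnS.
Qed.

End NatSums.

(** * Integer exponents for fractional powers: p to the power [quot_exp s r] is q^(1/2^(r-1)) *)

Definition quot_exp (s r : nat) : nat := s %/ 2 ^ (r - 1).

(* q^((2^(r-2) - 1) / 2^(r-1)) for q = p^s; the divisions are exact as 2^(M-2) | s. *)
Definition gauss_scale (p s r : nat) : nat := p ^ (s./2 - quot_exp s r).

Section Exponents.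
Variables p s M : nat.
Hypotheses (p8 : (p %% 8 = 3)%N) (M4 : (4 <= M)%N) (Mdiv : (2 ^ M %| p ^ s - 1)%N).

Lemma s_dvd : (2 ^ (M - 2) %| s)%N.
Proof.
have := exp_pred_dvd_two_pow p8 (M - 3) s.
have -> : (M - 3).+3 = M by lia.
have -> : (M - 3).+1 = (M - 2)%N by lia.
by rewrite Mdiv => <-.
Qed.

Lemma s_dvd4 : (4 %| s)%N.
Proof.
by apply: dvdn_trans s_dvd; rewrite (_ : 4 = 2 ^ 2)%N // dvdn_exp2l //; lia.
Qed.

Lemma s_even : ~~ odd s.
Proof. by have /dvdnP[k ->] := s_dvd4; clear; lia. Qed.

Lemma s_half_even : ~~ odd s./2.
Proof. by have /dvdnP[k ->] := s_dvd4; clear; lia. Qed.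

Lemma s_halfK : (s./2 + s./2 = s)%N.
Proof. by have /dvdnP[k ->] := s_dvd4; clear; lia. Qed.

Lemma quot_expK r : (1 <= r < M)%N -> s = (2 ^ (r - 1) * quot_exp s r)%N.
Proof.
move=> rM; rewrite /quot_exp mulnC divnK //; apply: dvdn_trans s_dvd.
by rewrite dvdn_exp2l //; lia.
Qed.

Lemma quot_expS r : (1 <= r)%N -> (r.+1 < M)%N -> quot_exp s r = (2 * quot_exp s r.+1)%N.
Proof.
move=> r1 rM; have a := @quot_expK r; have b := @quot_expK r.+1.
have e : (2 ^ (r.+1 - 1) = 2 ^ (r - 1) * 2)%N by rewrite -expnSr; congr (2 ^ _)%N; lia.
apply/eqP; rewrite -(@eqn_pmul2l (2 ^ (r - 1))) ?expn_gt0 // -a; last by lia.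
by rewrite mulnA -e -b //; lia.
Qed.

Lemma quot_exp2 : quot_exp s 2 = s./2.
Proof. by rewrite /quot_exp expn1 divn2. Qed.

Lemma quot_exp_double r : (2 <= r < M)%N -> (s %/ 2 ^ (r - 2) = 2 * quot_exp s r)%N.
Proof.
case: r => [|[|k]] // rM.
by have -> : (k.+2 - 2 = k.+1 - 1)%N by []; exact: quot_expS.
Qed.

Lemma quot_exp_le r : (2 <= r < M)%N -> (quot_exp s r <= s./2)%N.
Proof.
move=> rM; rewrite -quot_exp2 /quot_exp; apply: leq_div2l; first by rewrite expn_gt0.
by rewrite leq_exp2l //; lia.
Qed.

Lemma gauss_scale_prod r : (2 <= r < M)%N ->
  (p ^ s./2 * gauss_scale p s r = p ^ (s - quot_exp s r))%N.
Proof.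
move=> rM; rewrite -expnD; congr (p ^ _)%N.
by rewrite addnBA ?quot_exp_le // s_halfK.
Qed.

(** The power-of-p part of the recursion G_(r+1)^2 = - sqrt q G_r: in exponents of q, 1/2 + (1/2 -
    1/2^(r-1)) = 2 (1/2 - 1/2^r). *)
Lemma gauss_scale_sqr r : (2 <= r)%N -> (r.+1 < M)%N ->
  (p ^ s./2 * gauss_scale p s r = gauss_scale p s r.+1 * gauss_scale p s r.+1)%N.
Proof.
move=> r2 rM; rewrite gauss_scale_prod; last by lia.
rewrite -expnD; congr (p ^ _)%N; rewrite (quot_expS (ltnW r2) rM).
have r1 : (2 <= r.+1 < M)%N by lia.
have := quot_exp_le r1; have := s_halfK; move: (s./2) (quot_exp s r.+1) => h K; clear; lia.
Qed.

End Exponents.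

(** * Characters of 2-power order *)

Section TwoPowerCharacters.
Variables (F : finFieldType) (p s M : nat).
Hypotheses (p_pr : prime p) (p8 : (p %% 8 = 3)%N) (cardF : #|F| = (p ^ s)%N).
Hypotheses (M4 : (4 <= M)%N) (Mdiv : (2 ^ M %| p ^ s - 1)%N).
Variables (g : F) (z zeta : algC) (tr : F -> 'F_p).
Hypotheses (gP : (#|F|.-1).-primitive_root g).
Hypotheses (zP : (2 ^ M).-primitive_root z) (zetaP : p.-primitive_root zeta).
Hypotheses (trD : {morph tr : x y / x + y}) (trX : forall x, tr (x ^+ p) = tr x).
Hypotheses (trM : forall (c : 'F_p) x, tr (prime_emb F c * x) = c * tr x).
Hypothesis (tr1 : exists x, tr x = 1).

Local Notation Ks := (quot_exp s).
Local Notation cs := (gauss_scale p s).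
Let s_even := s_even p8 M4 Mdiv.
Let s_half_even := s_half_even p8 M4 Mdiv.
Let s_halfK := s_halfK p8 M4 Mdiv.
Let KsK := quot_expK p8 M4 Mdiv.
Let KsS := quot_expS p8 M4 Mdiv.
Let Ks_exponent := quot_exp_double p8 M4 Mdiv.
Let Ks_le := quot_exp_le p8 M4 Mdiv.
Let cs_prod := gauss_scale_prod p8 M4 Mdiv.
Let cs_sqr := gauss_scale_sqr p8 M4 Mdiv.

Lemma two_pow_dvd_order : (2 ^ M %| #|F|.-1)%N.
Proof. by rewrite cardF -subn1. Qed.

Lemma eqmod_order a b : a = b %[mod #|F|.-1] -> a = b %[mod 2 ^ M].
Proof.
move=> ab; rewrite -(modn_dvdm a two_pow_dvd_order) ab.
by rewrite modn_dvdm ?two_pow_dvd_order.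
Qed.

(** All characters of order dividing 2^M are powers of [chi 1], so they are indexed by an exponent
    modulo 2^M; index 2^(M-r) has order 2^r. *)
Definition chi (j : nat) (x : F) : algC :=
  if x == 0 then 0 else z ^+ (j * dlog g x).

Lemma zX_eqmod a b : a = b %[mod 2 ^ M] -> z ^+ a = z ^+ b.
Proof. by move=> /eqP; rewrite -(eq_prim_root_expr zP) => /eqP. Qed.

Lemma eqmodM (d j a b : nat) : a = b %[mod d] -> (j * a = j * b %[mod d])%N.
Proof. by move=> e; rewrite -modnMmr e modnMmr. Qed.

Lemma chi_gen j i : chi j (g ^+ i) = z ^+ (j * i).
Proof.
rewrite /chi (negPf (generatorX_neq0 gP i)).
by apply/zX_eqmod/eqmodM/eqmod_order/dlog_gen.
Qed.

Lemma chi_mult j : mult_char (chi j).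
Proof.
split; first by rewrite /chi eqxx.
  by rewrite -(expr0 g) chi_gen muln0.
move=> x y; have [->|x0] := eqVneq x 0; first by rewrite mul0r /chi eqxx mul0r.
have [->|y0] := eqVneq y 0; first by rewrite mulr0 /chi eqxx mulr0.
rewrite -(dlogK gP x0) -(dlogK gP y0) -exprD !chi_gen mulnDr exprD //.
Qed.

Lemma chi_eqmod j k x : j = k %[mod 2 ^ M] -> chi j x = chi k x.
Proof.
move=> jk; rewrite /chi; case: ifP => // _; apply: zX_eqmod.
by rewrite ![(_ * dlog _ _)%N]mulnC; apply: eqmodM.
Qed.

Lemma chiM j k x : chi j x * chi k x = chi (j + k) x.
Proof.
by rewrite /chi; case: ifP => _; rewrite ?mul0r // -exprD mulnDl.
Qed.

Lemma chiX j k x : (0 < k)%N -> chi j x ^+ k = chi (j * k) x.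
Proof.
move=> k0; rewrite /chi; case: ifP => _; last by rewrite -exprM mulnAC.
by rewrite expr0n; case: k k0.
Qed.

Lemma chi_nontrivial j : ~~ (2 ^ M %| j)%N -> nontrivial_mult (chi j).
Proof.
move=> jM; exists g; first exact: generator_neq0 gP.
by rewrite -{1}(expr1 g) chi_gen muln1 -(prim_order_dvd zP).
Qed.

Lemma chi_conj j k x : (2 ^ M %| j + k)%N -> (chi j x)^* = chi k x.
Proof.
move=> jk; have [->|x0] := eqVneq x 0; first by rewrite /chi eqxx rmorph0.
apply: (mulfI (mult_char_neq0 (chi_mult j) x0)).
rewrite (mult_char_norm (chi_mult j)) // chiM (@chi_eqmod _ 0); last first.
  by rewrite mod0n; apply/eqP.
by rewrite /chi (negPf x0).
Qed.

Lemma p_odd : odd p.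
Proof. by move: p8; rewrite {2}(divn_eq p 8); lia. Qed.

Lemma card_pred_half : #|F|.-1 = ((#|F|.-1)./2).*2%N.
Proof.
rewrite even_halfK // -dvdn2; apply: dvdn_trans two_pow_dvd_order.
by rewrite -{1}(expn1 2) dvdn_exp2l // (leq_trans _ M4).
Qed.

Lemma two_neq0 : 2%:R != 0 :> F.
Proof.
rewrite -(dvdn_pcharf (finField_pchar p_pr cardF)); apply/negP => d.
by move: d (p_odd); rewrite dvdn_prime2 // => /eqP ->.
Qed.

Lemma gen_half : g ^+ (#|F|.-1)./2 = -1.
Proof.
have h : (g ^+ (#|F|.-1)./2) ^+ 2 = 1.
  by rewrite -exprM muln2 -card_pred_half (prim_expr_order gP).
have /eqP := h; rewrite sqrf_eq1 => /orP[|/eqP //].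
rewrite -(prim_order_dvd gP) => d.
have q0 := prim_order_gt0 gP; have e := card_pred_half.
have h0 : (0 < (#|F|.-1)./2)%N by lia.
by have := dvdn_leq h0 d; lia.
Qed.

Lemma chi_opp1 j : chi j (-1) = z ^+ (j * (#|F|.-1)./2).
Proof. by rewrite -gen_half chi_gen. Qed.

Lemma chi_opp1_even j : ~~ odd j -> chi j (-1) = 1.
Proof.
move=> ej; rewrite chi_opp1; apply/eqP; rewrite -(prim_order_dvd zP).
have -> : (j * (#|F|.-1)./2 = j./2 * #|F|.-1)%N.
  by rewrite [in RHS]card_pred_half -[in LHS](even_halfK ej) -!muln2 mulnAC mulnA.
by rewrite dvdn_mull ?two_pow_dvd_order.
Qed.

(** This removes the factor chi(4) from the product formula. By Fermat 4^((p-1)/2) = 2^(p-1) = 1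
    with (p-1)/2 odd, while [chi j] has 2-power order. *)
Lemma chi_four j : chi j 4%:R = 1.
Proof.
have p0 := prime_gt0 p_pr; have pch := finField_pchar p_pr cardF.
have e4 : 4%:R = 2%:R ^+ 2 :> F by rewrite -natrX.
have four0 : 4%:R != 0 :> F by rewrite e4 expf_neq0 // two_neq0.
apply: (@odd_two_pow_order1 _ _ p./2 M).
- by move: p8; rewrite {1}(divn_eq p 8); lia.
- rewrite -(mult_charX _ _ (chi_mult j)).
  have -> : 4%:R ^+ p./2 = 1 :> F; last by case: (chi_mult j).
  apply: (mulfI two_neq0); rewrite e4 -exprM -exprS mulr1.
  have -> : (2 * p./2).+1 = p by have := odd_double_half p; rewrite p_odd; lia.
  have := prime_emb_frob p_pr cardF (2%:R : 'F_p) 1.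
  by rewrite expn1 (prime_emb_natr p_pr cardF).
rewrite chiX ?expn_gt0 // (@chi_eqmod _ 0); last by rewrite modnMl mod0n.
by rewrite /chi (negPf four0).
Qed.

Definition psi (x : F) : algC := zeta ^+ (tr x : nat).

Lemma zetaX_Fp (c : 'F_p) n : n%:R = c -> zeta ^+ n = zeta ^+ (c : nat).
Proof.
move=> e; apply/eqP; rewrite (eq_prim_root_expr zetaP) -e val_Fp_nat //.
by rewrite modn_mod.
Qed.

Lemma zetaD (c d : 'F_p) :
  zeta ^+ ((c + d)%R : nat) = zeta ^+ (c : nat) * zeta ^+ (d : nat).
Proof. by rewrite -exprD; apply/esym/zetaX_Fp; rewrite natrD !natr_Zp. Qed.

Lemma zeta_add_char : @add_char 'F_p (fun c : 'F_p => zeta ^+ (c : nat)).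
Proof.
have z0 : zeta ^+ ((0%R : 'F_p) : nat) = 1 by [].
split=> //; first exact: zetaD.
  move=> c; have u : zeta ^+ (c : nat) * (zeta ^+ (c : nat))^* = 1.
    rewrite -normCK -[RHS](expr1n _ 2); congr (_ ^+ 2); apply/eqP.
    rewrite -(@pexpr_eq1 _ _ p) ?prime_gt0 // -normrX -exprM mulnC exprM.
    by rewrite (prim_expr_order zetaP) expr1n normr1.
  have c0 : zeta ^+ (c : nat) != 0.
    by apply/eqP => c0; move/eqP: u; rewrite c0 mul0r eq_sym oner_eq0.
  by apply: (mulfI c0); rewrite u -zetaD subrr.
exists 1; rewrite -(@zetaX_Fp 1 1) // expr1 -[zeta]expr1 -(prim_order_dvd zetaP).
by rewrite gtnNdvd // prime_gt1.
Qed.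

Lemma trace0 : tr 0 = 0.
Proof. by apply: (addIr (tr 0)); rewrite -trD !add0r. Qed.

Lemma psi_add_char : add_char psi.
Proof.
have [h0 hD hN _] := zeta_add_char.
have tN x : tr (- x) = - tr x.
  by apply: (addIr (tr x)); rewrite -trD !addNr trace0.
split; rewrite /psi ?trace0 //.
- by move=> x y; rewrite trD zetaD.
- by move=> x; rewrite tN hN.
have [x x1] := tr1; exists x; rewrite x1.
rewrite -(@zetaX_Fp 1 1) // expr1 -[zeta]expr1 -(prim_order_dvd zetaP).
by rewrite gtnNdvd // prime_gt1.
Qed.

Definition Gs (j : nat) : algC := gauss (chi j) psi.

Lemma Gs_eqmod j k : j = k %[mod 2 ^ M] -> Gs j = Gs k.
Proof. by move=> jk; apply: eq_bigr => x _; rewrite (chi_eqmod _ jk). Qed.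

Lemma frob_inj : injective (fun x : F => x ^+ p).
Proof.
move=> x y /= e; apply/eqP; rewrite -subr_eq0.
have := frobeniusD p_pr cardF (x - y) y 1; rewrite expn1 subrK e => /esym/eqP.
by rewrite -[X in _ == X]add0r (inj_eq (addIr _)) expf_eq0 => /andP[].
Qed.

Lemma chi_frob j x : chi j (x ^+ p) = chi (j * p) x.
Proof. by rewrite (mult_charX _ _ (chi_mult j)) chiX ?prime_gt0. Qed.

(** The substitution x -> x^p preserves the trace, hence [psi]. *)
Lemma Gs_frob j i : Gs (j * p ^ i) = Gs j.
Proof.
elim: i => [|i IHi]; first by rewrite muln1.
rewrite -IHi [RHS]/Gs /gauss (reindex_inj frob_inj).
by apply: eq_bigr => x _; rewrite chi_frob -mulnA -expnSr /psi trX.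
Qed.

Lemma Gs_conj j k : (2 ^ M %| j + k)%N -> (Gs j)^* = chi j (-1) * Gs k.
Proof.
move=> jk; rewrite (gauss_conj (chi_mult j) psi_add_char); congr (_ * _).
by apply: eq_bigr => x _; rewrite (chi_conj _ jk).
Qed.

Lemma Gs_norm j : ~~ (2 ^ M %| j)%N -> Gs j * (Gs j)^* = (p ^ s)%:R.
Proof.
move=> jM; rewrite (gauss_norm (chi_mult j) (chi_nontrivial jM) psi_add_char).
by rewrite cardF.
Qed.

Lemma Gs0 : Gs 0 = -1.
Proof.
have := sum_add_char psi_add_char; rewrite (bigD1 0) //=.
case: psi_add_char => -> _ _ _ /eqP; rewrite addrC addr_eq0 => /eqP <-.
rewrite /Gs /gauss (bigD1 0) //=; case: (chi_mult 0) => -> _ _.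
rewrite mul0r add0r; apply: eq_bigr => x x0.
by rewrite /chi (negPf x0) mul1r.
Qed.

Lemma z_half : z ^+ (2 ^ M.-1) = -1.
Proof.
have M0 : (0 < M)%N by apply: leq_trans M4.
have h : (z ^+ (2 ^ M.-1)) ^+ 2 = 1.
  by rewrite -exprM -expnSr prednK // (prim_expr_order zP).
have /eqP := h; rewrite sqrf_eq1 => /orP[|/eqP //].
rewrite -(prim_order_dvd zP) dvdn_Pexp2l // => d.
by move: d; rewrite leqNgt ltn_predL M0.
Qed.

Lemma quad_count (y : F) :
  #|[set t : F | t ^+ 2 == y]|%:R = 1 + chi (2 ^ M.-1) y :> algC.
Proof.
have [->|y0] := eqVneq y 0.
  rewrite /chi eqxx addr0 (_ : [set _ | _] = [set 0]) ?cards1 //.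
  by apply/setP => t; rewrite !inE sqrf_eq0.
rewrite -(dlogK gP y0) chi_gen exprM z_half; set i := dlog g y.
rewrite -signr_odd; case oi: (odd i) => /=.
  rewrite (_ : [set _ | _] = set0) ?cards0 ?expr1 ?subrr //.
  apply/setP => t; rewrite !inE; apply/negP => /eqP e.
  have t0 : t != 0.
    apply/eqP => t0; have := generatorX_neq0 gP i.
    by rewrite -e t0 expr0n eqxx.
  have /eqP := e; rewrite -(dlogK gP t0) -exprM (eq_prim_root_expr gP) => /eqP h.
  move/(congr1 odd): h; rewrite card_pred_half !odd_mod ?odd_double //.
  by rewrite muln2 odd_double oi.
set w := g ^+ i./2; have w0 : w != 0 by apply: generatorX_neq0.
rewrite (_ : [set _ | _] = [set w; - w]).
  rewrite cards2 (_ : w != - w) //; last first.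
  rewrite -addr_eq0 -mulr2n -mulr_natl mulf_neq0 ?two_neq0 //.
apply/setP => t; rewrite !inE -eqf_sqr -exprM muln2 even_halfK ?oi //.
Qed.

Lemma Gs_double j : ~~ (2 ^ M %| 2 * j)%N ->
  Gs j * Gs (j + 2 ^ M.-1) = Gs (2 * j) * Gs (2 ^ M.-1).
Proof.
move=> jM; have M0 : (0 < M)%N by apply: leq_trans M4.
have e (k l : nat) : gauss (fun x => chi k x * chi l x) psi = Gs (k + l).
  by apply: eq_bigr => x _; rewrite chiM.
have nt2 : nontrivial_mult (fun x => chi j x * chi j x).
  have [x x0 h] : nontrivial_mult (chi (2 * j)) by apply: chi_nontrivial.
  by exists x => //; rewrite chiM addnn -mul2n.
have nth : nontrivial_mult (fun x => chi j x * chi (2 ^ M.-1) x).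
  have [|x x0 h] := @chi_nontrivial (j + 2 ^ M.-1); last first.
    by exists x => //; rewrite chiM.
  apply: contra jM => /(dvdn_mull 2); rewrite mulnDr -expnS prednK //.
  by rewrite dvdn_addl.
have nt1 : nontrivial_mult (chi j).
  by apply: chi_nontrivial; apply: contra jM => /(dvdn_mull 2).
have := gauss_double (chi_mult j) (chi_mult (2 ^ M.-1)) nt1 nt2 nth psi_add_char
  two_neq0 quad_count.
by rewrite !e chi_four rmorph1 mul1r addnn -mul2n.
Qed.

Definition G (r : nat) : algC := Gs (2 ^ (M - r)).

Lemma two_pow_index_ndvd r : (0 < r <= M)%N -> ~~ (2 ^ M %| 2 ^ (M - r))%N.
Proof. by move=> r0; rewrite dvdn_Pexp2l // -ltnNge; lia. Qed.

Lemma G_norm r : (0 < r <= M)%N -> G r * (G r)^* = (p ^ s)%:R.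
Proof. by move=> r0; apply/Gs_norm/two_pow_index_ndvd. Qed.

Lemma Gs_double_index r : (1 < r <= M)%N ->
  G r * Gs (2 ^ (M - r) + 2 ^ M.-1) = G r.-1 * G 1.
Proof.
move=> r1; have e : (2 * 2 ^ (M - r) = 2 ^ (M - r.-1))%N.
  by rewrite -expnS; congr (2 ^ _)%N; lia.
rewrite Gs_double e; first by rewrite /G subn1.
by apply: two_pow_index_ndvd; lia.
Qed.

(** For r >= 4 the factor 1 + 2^(r-1) is a power of p modulo 2^r, so both Gauss sums on the left of
    the product formula equal [G r]. *)
Lemma G_sqr r : (3 < r <= M)%N -> G r ^+ 2 = G r.-1 * G 1.
Proof.
move=> r4; rewrite -Gs_double_index; last by lia.
rewrite expr2; congr (_ * _).
have [k rk] : exists k, r = k.+4 by exists (r - 4)%N; lia.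
have [u ou hu] := exp_two_pow_step p8 k.
rewrite [LHS]/G -(Gs_frob _ (2 ^ k.+1)) hu; apply: Gs_eqmod.
have -> : (2 ^ (M - r) * (u * 2 ^ k.+3).+1 = 2 ^ (M - r) + u * 2 ^ M.-1)%N.
  rewrite mulnS; congr (_ + _)%N; rewrite mulnCA -expnD; congr (_ * 2 ^ _)%N.
  by lia.
apply/eqP; rewrite eqn_modDl; apply/eqP; rewrite -(odd_double_half u) ou mulnDl mul1n -modnDmr.
rewrite -muln2 -mulnA -expnS prednK; last by lia.
by rewrite modnMl addn0.
Qed.

Lemma frob_index r : (r <= 3)%N ->
  (2 ^ (M - r) * p = 2 ^ (M - r) * 3 %[mod 2 ^ M])%N.
Proof.
move=> r3; rewrite [in LHS](divn_eq p 8) p8 mulnDr -modnDml.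
have -> : (2 ^ (M - r) * (p %/ 8 * 8) = p %/ 8 * 2 ^ (3 - r) * 2 ^ M)%N.
  rewrite mulnCA -mulnA; congr (_ * _)%N; rewrite (_ : 8 = 2 ^ 3)%N // -!expnD.
  by congr (2 ^ _)%N; lia.
by rewrite modnMl.
Qed.

(** For r = 3 the second index carries the factor 1 + 4 = 5, and 5 p = -1 mod 8: the product formula
    then pairs [G 3] with its conjugate. *)
Lemma G12 : G 2 * G 1 = (p ^ s)%:R.
Proof.
rewrite -(@Gs_double_index 3) ?M4 ?(ltnW M4) // -(@G_norm 3) ?(ltnW M4) //.
congr (_ * _); rewrite (@Gs_conj _ (7 * 2 ^ (M - 3))); last first.
  rewrite -mulSn (_ : 8 = 2 ^ 3)%N // -expnD subnKC //; exact: ltnW.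
rewrite chi_opp1_even ?mul1r; last by rewrite oddX; lia.
have -> : (2 ^ (M - 3) + 2 ^ M.-1 = 5 * 2 ^ (M - 3))%N.
  have -> : (M.-1 = M - 3 + 2)%N by lia.
  by rewrite expnD mulSn; lia.
rewrite -(Gs_frob _ 1) expn1; apply: Gs_eqmod.
have e := @frob_index 3 isT.
rewrite -mulnA -modnMmr e modnMmr mulnA mulnAC.
have -> : (5 * 3 * 2 ^ (M - 3) = 7 * 2 ^ (M - 3) + 2 ^ M)%N.
  have -> : (2 ^ M = 2 ^ (M - 3) * 2 ^ 3)%N by rewrite -expnD subnK // ltnW.
  by lia.
by rewrite modnDr.
Qed.

Lemma G1_real : (G 1)^* = G 1.
Proof.
rewrite (@Gs_conj _ (2 ^ (M - 1))); last first.
  by rewrite addnn -mul2n -expnS; rewrite subn1 prednK //; lia.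
by rewrite chi_opp1_even ?mul1r // oddX; lia.
Qed.

Lemma G1_sqr : G 1 ^+ 2 = (p ^ s)%:R.
Proof. by rewrite expr2 -{2}G1_real; apply: G_norm; lia. Qed.

Lemma G_neq0 r : (0 < r <= M)%N -> G r != 0.
Proof.
move=> r0; apply: gauss_neq0; first exact: chi_mult.
  exact/chi_nontrivial/two_pow_index_ndvd.
exact: psi_add_char.
Qed.

Lemma G2_G1 : G 2 = G 1.
Proof.
apply: (mulIf (@G_neq0 1 _)); first by lia.
by rewrite G12 -expr2 G1_sqr.
Qed.

(** Orthogonality over the characters of order dividing 2^r singles out the x on which all of them
    are 1. *)
Lemma coset_sum r a : (r <= M)%N -> a != 0 ->
  \sum_(j < 2 ^ r) (chi (j * 2 ^ (M - r)) a)^* * Gs (j * 2 ^ (M - r))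
  = (2 ^ r)%:R * \sum_(x | (x != 0) && (chi (2 ^ (M - r)) x == 1)) psi (a * x).
Proof.
move=> rM a0; set J := (2 ^ (M - r))%N.
transitivity (\sum_x psi (a * x) * \sum_(j < 2 ^ r) chi (j * J) x).
  under eq_bigr => j _ do
    rewrite -(gauss_twist (chi_mult _) psi_add_char a0).
  rewrite exchange_big; apply: eq_bigr => x _.
  by rewrite mulr_sumr; apply: eq_bigr => j _; rewrite mulrC.
rewrite mulr_sumr [RHS]big_mkcond; apply: eq_bigr => x _.
have [->|x0] /= := eqVneq x 0.
  by rewrite big1 ?mulr0 // => j _; case: (chi_mult (j * J)).
have xj j : chi (j * J) x = chi J x ^+ j.
  by rewrite /chi (negPf x0) -exprM; congr (_ ^+ _); lia.
under eq_bigr do rewrite xj.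
have [->|w1] := eqVneq (chi J x) 1.
  under eq_bigr do rewrite expr1n.
  by rewrite sumr_const card_ord mulrC.
have : chi J x ^+ (2 ^ r) - 1 = 0.
  rewrite chiX ?expn_gt0 // /J -expnD subnK // (@chi_eqmod _ 0).
    by rewrite /chi (negPf x0) subrr.
  by rewrite modnn mod0n.
rewrite subrX1 => /eqP; rewrite mulf_eq0 subr_eq0 (negPf w1) /= => /eqP->.
by rewrite mulr0.
Qed.

Lemma psi_Aint x : psi x \in Aint.
Proof.
apply: (@Aint_unity_root p); first exact: prime_gt0.
apply/unity_rootP; rewrite -exprM mulnC exprM (prim_expr_order zetaP).
by rewrite expr1n.
Qed.

(** The coset sum with r = 2 and a = 1 is -1 + 3 G_1 = 4Y, where Y is a rational algebraic integer.
    As s/2 is even, sqrt q = 1 mod 8, and G_1 = sqrt q would give 4Y = 2 mod 8. *)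
Lemma G1_value : G 1 = - (p ^ s./2)%:R.
Proof.
have /eqP : G 1 ^+ 2 = (p ^ s./2)%:R ^+ 2.
  by rewrite G1_sqr -natrX -expnM muln2 -addnn s_halfK.
rewrite eqf_sqr => /orP[]/eqP // h.
have M2 : (2 <= M)%N by lia.
have := @coset_sum 2 1 M2 (oner_neq0 _); set Y := (X in _ = _ * X).
rewrite (_ : (2 ^ 2)%N = 4%N) // !big_ord_recl big_ord0 /= /bump /= !addn0 !add1n mul0n addr0 mul1n.
have c1 j : (chi j 1)^* = 1 by case: (chi_mult j) => _ -> _; rewrite rmorph1.
rewrite !c1 !mul1r Gs0 -/(G 2).
have -> : (2 * 2 ^ (M - 2) = 2 ^ (M - 1))%N by rewrite -expnS; congr (2 ^ _)%N; lia.
have -> : Gs (3 * 2 ^ (M - 2)) = G 2.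
  rewrite [RHS]/G -(Gs_frob (2 ^ (M - 2)) 1) expn1 mulnC; apply: Gs_eqmod.
  by rewrite frob_index.
rewrite -/(G 1) G2_G1 h => e.
have {}e : 4 * Y = 3 * (p ^ s./2)%:R - 1 by rewrite -e; ring.
have Yrat : Y \in Crat.
  have -> : Y = (3 * (p ^ s./2)%:R - 1) / 4 by rewrite -e mulrC mulKf // pnatr_eq0.
  by rewrite !(rpred_div, rpredB, rpredM, rpred_nat, rpred1).
have YA : Y \in Aint by apply: rpred_sum => x _; exact: psi_Aint.
have /intrP[y yE] := Cint_rat_Aint Yrat YA.
have : (3 * (p ^ s./2)%:Z - 1)%:~R = (4 * y)%:~R :> algC.
  by rewrite rmorphB !rmorphM /= -yE; exact/esym.
move=> /intr_inj; have := exp_even_mod8 p8 s_half_even.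
by move: (p ^ s./2)%N => Q; lia.
Qed.

(** * Eisenstein sums and the Gauss sums of the prime field *)

Definition trace_one_sum (j : nat) : algC := \sum_(y | tr y == 1) chi j y.

(** The elements of trace c != 0 are c times those of trace 1. Applied with f = 1 as well, this
    eliminates the sum over trace 0. *)
Lemma chi_weighted_sum j (f : 'F_p -> algC) :
  \sum_x chi j x * f (tr x)
  = (\sum_(c : 'F_p | c != 0) chi j (prime_emb F c) * f c) * trace_one_sum j
    + f 0 * \sum_(y | tr y == 0) chi j y.
Proof.
case: (chi_mult j) => _ _ cM.
rewrite (partition_big tr predT) //= (bigD1 0) //= addrC; congr (_ + _).
  rewrite mulr_suml; apply: eq_bigr => c c0.
  have e0 : prime_emb F c != 0 by rewrite (prime_emb_eq0 p_pr cardF).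
  rewrite (reindex_inj (mulfI e0)) /trace_one_sum mulr_sumr; apply: eq_big => y.
    by rewrite trM -[X in _ == X]mulr1 (inj_eq (mulfI c0)).
  by move=> /eqP->; rewrite cM mulrAC.
by rewrite mulr_sumr; apply: eq_bigr => y /eqP->; rewrite mulrC.
Qed.

Lemma prime_emb_half (c : 'F_p) : c != 0 ->
  prime_emb F c ^+ (p./2 * 2) = 1.
Proof.
move=> c0; have e0 : prime_emb F c != 0 by rewrite (prime_emb_eq0 p_pr cardF).
apply: (mulfI e0); rewrite -exprS mulr1 muln2.
have -> : (p./2.*2).+1 = p by rewrite -{2}(odd_double_half p) p_odd.
by have := prime_emb_frob p_pr cardF c 1; rewrite expn1.
Qed.

Lemma p_half_odd : odd p./2.
Proof. by move: p8; rewrite {1}(divn_eq p 8); lia. Qed.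

Lemma chi_two_pow j x : x != 0 -> chi j x ^+ (2 ^ M) = 1.
Proof.
move=> x0; rewrite chiX ?expn_gt0 // (@chi_eqmod _ 0); last by rewrite modnMl mod0n.
by rewrite /chi (negPf x0).
Qed.

(** p - 1 is twice an odd number, so a character of 2-power order is trivial or quadratic on the
    prime field. *)
Lemma chi_prime_emb_sqr j (c : 'F_p) : c != 0 -> chi j (prime_emb F c) ^+ 2 = 1.
Proof.
move=> c0; have e0 : prime_emb F c != 0 by rewrite (prime_emb_eq0 p_pr cardF).
apply: (@odd_two_pow_order1 _ _ p./2 M); first exact: p_half_odd.
  rewrite -!(mult_charX _ _ (chi_mult j)) -exprM mulnC prime_emb_half //.
  by case: (chi_mult j).
by rewrite -exprM mulnC exprM chi_two_pow ?expr1n.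
Qed.

Lemma chi_prime_emb_trivial j (c : 'F_p) : c != 0 -> chi j (-1) = 1 ->
  chi j (prime_emb F c) = 1.
Proof.
move=> c0 cN1; have e0 : prime_emb F c != 0 by rewrite (prime_emb_eq0 p_pr cardF).
apply: (@odd_two_pow_order1 _ _ p./2 M); first exact: p_half_odd.
  rewrite -!(mult_charX _ _ (chi_mult j)).
  have /eqP := prime_emb_half c0; rewrite exprM sqrf_eq1 => /orP[]/eqP-> //.
  by case: (chi_mult j).
exact: chi_two_pow.
Qed.

Lemma Gs_trace_one j : ~~ (2 ^ M %| j)%N -> chi j (-1) = 1 ->
  Gs j = - p%:R * trace_one_sum j.
Proof.
move=> jM cN1.
have -> : Gs j = _ := chi_weighted_sum j (fun c => zeta ^+ (c : nat)).
have := chi_weighted_sum j (fun=> 1).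
under eq_bigr do rewrite mulr1.
rewrite (sum_mult_char (chi_mult j) (chi_nontrivial jM)) mul1r => /esym/eqP.
rewrite addrC addr_eq0 => /eqP->.
have -> : \sum_(c : 'F_p | c != 0) chi j (prime_emb F c) * 1 = (p.-1)%:R.
  rewrite (eq_bigr (fun=> 1)) => [|c c0]; last by rewrite chi_prime_emb_trivial ?mulr1.
  by rewrite sumr_const cardC1 card_Fp.
have -> : \sum_(c : 'F_p | c != 0) chi j (prime_emb F c) * zeta ^+ (c : nat) = -1.
  rewrite (eq_bigr (fun c : 'F_p => zeta ^+ (c : nat))) => [|c c0]; last first.
    by rewrite chi_prime_emb_trivial // mul1r.
  have := sum_add_char zeta_add_char; rewrite (bigD1 0) //= => /eqP.
  by rewrite addrC addr_eq0 => /eqP->.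
have -> : p%:R = (p.-1)%:R + 1 :> algC by rewrite natr1 prednK ?prime_gt0.
by ring.
Qed.

(** [chi j] restricts to the quadratic character of the prime field; [gam] is its Gauss sum there,
    with square -p because that character is -1 at -1. *)
Lemma Gs_trace_one_odd j : chi j (-1) != 1 ->
  exists2 gam : algC, gam ^+ 2 = - p%:R & Gs j = gam * trace_one_sum j.
Proof.
move=> cN1.
pose phi (c : 'F_p) := chi j (prime_emb F c).
have emb1 : prime_emb F (1 : 'F_p) = 1 := prime_emb_natr p_pr cardF 1.
have embN1 : prime_emb F (-1 : 'F_p) = -1.
  apply/eqP; rewrite -addr_eq0 -emb1 -(prime_embD p_pr cardF) addNr.
  by rewrite (prime_emb_eq0 p_pr cardF).
have phiP : mult_char phi.
  case: (chi_mult j) => c0 c1 cM; split; rewrite /phi.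
  - by apply: etrans c0; congr (chi j _); apply/eqP; rewrite (prime_emb_eq0 p_pr cardF).
  - by rewrite emb1.
  - by move=> c d; rewrite (prime_embM p_pr cardF).
have N10 : (-1 : 'F_p) != 0 by rewrite oppr_eq0 oner_eq0.
have phin : nontrivial_mult phi by exists (-1) => //; rewrite /phi embN1.
have phiN1 : phi (-1) = -1.
  have := chi_prime_emb_sqr j N10; rewrite -/(phi _) => /eqP; rewrite sqrf_eq1.
  by case/orP => /eqP // h; move: cN1; rewrite -embN1 -/(phi _) h eqxx.
exists (gauss phi (fun c : 'F_p => zeta ^+ (c : nat))).
  have := gauss_norm phiP phin zeta_add_char; rewrite card_Fp // => <-.
  rewrite (gauss_conj phiP zeta_add_char) phiN1 mulN1r mulrN opprK expr2.
  congr (_ * _); apply: eq_bigr => c _; congr (_ * _).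
  have [->|c0] := eqVneq c 0; first by case: phiP => -> _ _; rewrite rmorph0.
  apply: (mulfI (mult_char_neq0 phiP c0)); rewrite (mult_char_norm phiP) //.
  by rewrite -expr2 /phi chi_prime_emb_sqr.
have -> : Gs j = _ := chi_weighted_sum j (fun c => zeta ^+ (c : nat)).
have := chi_weighted_sum j (fun=> 1).
have := sum_mult_char phiP phin; rewrite (bigD1 0) //=.
case: (phiP) => -> _ _; rewrite add0r => e.
under [X in _ = X * _ + _]eq_bigr do rewrite mulr1.
rewrite e mul0r add0r mul1r => <-.
rewrite [X in _ + X = _](eq_bigr (chi j)) => [|x _]; last by rewrite mulr1.
rewrite (sum_mult_char (chi_mult j)) ?mulr0 ?addr0; last first.
  by exists (-1); rewrite ?oppr_eq0 ?oner_eq0.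
congr (_ * _); rewrite /gauss [RHS](bigD1 0) //=.
by case: (phiP) => -> _ _; rewrite mul0r add0r.
Qed.

(** * Values in Z[sqrt(-2)] and the Jacobi sum of order 8 *)

Definition zeta8 : algC := z ^+ (2 ^ (M - 3)).
Definition sqrtm2 : algC := zeta8 + zeta8 ^+ 3.

Lemma zeta8_4 : zeta8 ^+ 4 = -1.
Proof.
rewrite /zeta8 -exprM (_ : 4 = 2 ^ 2)%N // -expnD -z_half; congr (_ ^+ (2 ^ _)).
by lia.
Qed.

Lemma sqrtm2_sqr : sqrtm2 ^+ 2 = -2.
Proof.
have h := zeta8_4; rewrite /sqrtm2.
have -> : (zeta8 + zeta8 ^+ 3) ^+ 2
   = zeta8 ^+ 2 + 2 * zeta8 ^+ 4 + zeta8 ^+ 2 * zeta8 ^+ 4 by ring.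
by rewrite h; ring.
Qed.

Lemma sqrtm2_conj : sqrtm2^* = - sqrtm2.
Proof.
have u : zeta8 * zeta8^* = 1.
  have z1 : `|zeta8| = 1.
    apply/eqP; rewrite -(@pexpr_eq1 _ _ 4) // -normrX zeta8_4.
    by rewrite normrN normr1.
  by rewrite -normCK z1 expr1n.
have c : zeta8^* = - zeta8 ^+ 3.
  have z0 : zeta8 != 0.
    by apply/eqP => z0; move/eqP: u; rewrite z0 mul0r eq_sym oner_eq0.
  by apply: (mulfI z0); rewrite u mulrN -exprS zeta8_4 opprK.
have c3 : (zeta8 ^+ 3)^* = (zeta8^* ) ^+ 3 by rewrite !exprS expr0 !mulr1 !rmorphM.
rewrite /sqrtm2 rmorphD /= c3 c.
have -> : (- zeta8 ^+ 3) ^+ 3 = - (zeta8 ^+ 4 * zeta8 ^+ 4 * zeta8) by ring.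
by rewrite zeta8_4; ring.
Qed.

Lemma trace_one_sum_quad r : (3 <= r <= M)%N ->
  exists a b : int, trace_one_sum (2 ^ (M - r)) = a%:~R + b%:~R * sqrtm2.
Proof.
move=> r3; have [k rk] : exists k, r = k.+3 by exists (r - 3)%N; lia.
have st : frob_stable p (fun x : F => x ^+ p) (fun y => tr y == 1) (dlog g) k.+3.
  split=> [x|x t1]; first by rewrite trX.
  have x0 : x != 0 by apply: contraTneq t1 => ->; rewrite trace0 eq_sym oner_eq0.
  have h := eqmod_order (dlogX gP p x0).
  have d : (2 ^ k.+3 %| 2 ^ M)%N by rewrite dvdn_exp2l //; lia.
  by rewrite -(modn_dvdm _ d) h modn_dvdm.
have zk : (z ^+ (2 ^ (M - r))) ^+ (2 ^ k.+2) = -1.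
  by rewrite -exprM -expnD -z_half; congr (_ ^+ (2 ^ _)); lia.
have [a [b ab]] := frob_stable_sum p8 frob_inj st zk.
exists a, b; rewrite /sqrtm2 /zeta8.
have e : z ^+ (2 ^ (M - r)) ^+ (2 ^ k) = z ^+ (2 ^ (M - 3)).
  by rewrite -exprM -expnD; congr (_ ^+ (2 ^ _)); lia.
rewrite e in ab; rewrite -ab; apply: eq_bigr => y t1; rewrite /chi exprM.
by case: (y =P 0) t1 => // ->; rewrite trace0 eq_sym oner_eq0.
Qed.

Lemma sum_powers k : (0 < k)%N ->
  \sum_(x : F) x ^+ k = if (#|F|.-1 %| k)%N then -1 else 0.
Proof.
move=> k0; rewrite (bigD1 0) //= expr0n (gtn_eqF k0) add0r (sum_nonzero_gen gP).
under eq_bigr do rewrite exprAC.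
rewrite (prim_order_dvd gP); case: eqP => [->|/eqP w1].
  under eq_bigr do rewrite expr1n.
  rewrite sumr_const card_ord; apply: (addIr 1); rewrite addNr natr1 prednK.
    have := finField_pchar p_pr cardF => /(dvdn_pcharf) h; rewrite cardF.
    apply/eqP; rewrite -h; apply: dvdn_exp => //.
    by case: (s) cardF => // e; have := finNzRing_gt1 F; rewrite e.
  by rewrite (ltn_trans _ (finNzRing_gt1 F)).
have : (g ^+ k) ^+ #|F|.-1 - 1 = 0.
  by rewrite exprAC (prim_expr_order gP) expr1n subrr.
by rewrite subrX1 => /eqP; rewrite mulf_eq0 subr_eq0 (negPf w1) => /eqP.
Qed.

(** The expansion has exponents from 5t to 10t, among which only 8t = q - 1 has a nonzero power
    sum. *)
Lemma sum_symmetric_powers t : #|F| = (8 * t).+1 -> (0 < t)%N ->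
  \sum_(x : F) (x * (1 - x)) ^+ (5 * t) = - (-1) ^+ (3 * t) * 'C(5 * t, 3 * t)%:R.
Proof.
move=> qt t0.
transitivity (\sum_(i < (5 * t).+1) (-1) ^+ i * 'C(5 * t, i)%:R
    * \sum_(x : F) x ^+ (5 * t + i)).
  transitivity (\sum_(x : F) \sum_(i < (5 * t).+1)
      (-1) ^+ i * 'C(5 * t, i)%:R * x ^+ (5 * t + i)).
    apply: eq_bigr => x _; rewrite exprMn exprDn mulr_sumr; apply: eq_bigr => i _.
    by rewrite expr1n mul1r (exprNn x) -mulr_natl exprD; ring.
  by rewrite exchange_big; apply: eq_bigr => i _; rewrite mulr_sumr.
have i3 : (3 * t < (5 * t).+1)%N by lia.
rewrite (bigD1 (Ordinal i3)) //= [X in _ + X]big1 ?addr0.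
  rewrite sum_powers; last by lia.
  have -> : (5 * t + 3 * t = #|F|.-1)%N by rewrite qt /=; lia.
  by rewrite dvdnn mulrN1 mulNr.
move=> i ni; rewrite sum_powers; last by lia.
rewrite qt /=; case: ifP => [/dvdnP[k ek]|_]; last by rewrite mulr0.
have i5 : (i <= 5 * t)%N by rewrite -ltnS.
case/eqP: ni; apply: val_inj => /=.
have k1 : k = 1%N by case: k ek => [|[|k]] //; nia.
by move: ek; rewrite k1; lia.
Qed.

Lemma quad_norm (a b : int) :
  (a%:~R + b%:~R * sqrtm2) * (a%:~R + b%:~R * sqrtm2)^*
  = (a ^+ 2 + 2 * b ^+ 2)%:~R :> algC.
Proof.
have -> : (a%:~R + b%:~R * sqrtm2)^* = a%:~R - b%:~R * sqrtm2.
  by rewrite rmorphD rmorphM /= !rmorph_int sqrtm2_conj mulrN.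
rewrite mulrC -subr_sqr exprMn sqrtm2_sqr rmorphD rmorphM !rmorphXn /=.
by rewrite mulrN opprK [_ * 2]mulrC.
Qed.

Definition jac : algC := jacobi (chi (2 ^ (M - 3))) (chi (2 ^ (M - 3))).

Lemma jac_gauss : G 3 ^+ 2 = jac * G 2.
Proof.
have e : (2 ^ (M - 3) + 2 ^ (M - 3) = 2 ^ (M - 2))%N.
  by rewrite addnn -mul2n -expnS; congr (2 ^ _)%N; lia.
have nt : nontrivial_mult (fun x => chi (2 ^ (M - 3)) x * chi (2 ^ (M - 3)) x).
  have [|x x0 h] := @chi_nontrivial (2 ^ (M - 2)).
    by apply: two_pow_index_ndvd; lia.
  by exists x; rewrite // chiM e.
have := jacobi_gauss (chi_mult _) (chi_mult _) nt psi_add_char.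
rewrite -/jac expr2 => ->; congr (_ * _); apply: eq_bigr => x _.
by rewrite chiM e.
Qed.

Lemma jac_norm : jac * jac^* = (p ^ s)%:R.
Proof.
have q0 : (p ^ s)%:R != 0 :> algC by rewrite pnatr_eq0 -lt0n expn_gt0 prime_gt0.
apply: (mulIf q0); rewrite -{1}(@G_norm 2); last by lia.
rewrite mulrACA -rmorphM /= -jac_gauss rmorphXn /= -exprMn G_norm ?expr2 //.
by lia.
Qed.

(* Reducing J(chi, chi) modulo a prime above p gives, up to sign, the binomial
   coefficient C(5(q-1)/8, 3(q-1)/8), which is prime to p. *)
Lemma jac_quad : exists a b : int, [/\ jac = a%:~R + b%:~R * sqrtm2,
  a ^+ 2 + 2 * b ^+ 2 = (p ^ s)%N & ~~ (p %| a)%Z].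
Proof.
pose P := [pred x : F | (x != 0) && (1 - x != 0)].
pose e x := dlog g (x * (1 - x)).
have Px x : P x -> x * (1 - x) != 0 by move=> /andP[x0 x1]; rewrite mulf_neq0.
have frobB (x : F) : 1 - x ^+ p = (1 - x) ^+ p.
  have := frobeniusD p_pr cardF (1 - x) x 1; rewrite expn1 subrK expr1n => h.
  by apply/eqP; rewrite subr_eq; apply/eqP.
have st : frob_stable p (fun x : F => x ^+ p) P e 3.
  split=> [x|x Pxx] /=; first by rewrite frobB !expf_eq0 prime_gt0.
  rewrite /e frobB -exprMn; have h := eqmod_order (dlogX gP p (Px x Pxx)).
  have d : (2 ^ 3 %| 2 ^ M)%N by rewrite dvdn_exp2l // ltnW.
  by rewrite -(modn_dvdm _ d) h modn_dvdm.
have [c1 c2 c3] := frob_stable_counts p8 frob_inj st.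
set a := ((residue_count P e 0)%:Z - (residue_count P e 4)%:Z).
set b := ((residue_count P e 1)%:Z - (residue_count P e 5)%:Z).
have jE : jac = a%:~R + b%:~R * sqrtm2.
  rewrite -(sum_eighth_root zeta8_4 c1 c2 c3) [RHS]big_mkcond.
  apply: eq_bigr => x _; rewrite -[1 - x]/(1 - x).
  case: (chi_mult (2 ^ (M - 3))) => chi0 _ cM; rewrite -cM /=.
  have [->|x0] /= := eqVneq x 0; first by rewrite mul0r chi0.
  have [->|x1] /= := eqVneq (1 - x) 0; first by rewrite mulr0 chi0.
  by rewrite /chi mulf_eq0 (negPf x0) (negPf x1) exprM.
have ab : a ^+ 2 + 2 * b ^+ 2 = (p ^ s)%N.
  apply/eqP; rewrite -(eqr_int algC); apply/eqP.
  by rewrite -quad_norm -jE jac_norm.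
exists a, b; split=> //; apply/negP => pa.
have pch := finField_pchar p_pr cardF.
have s0 : (0 < s)%N by case: (s) cardF => // h; have := finNzRing_gt1 F; rewrite h.
have pb : (p %| b)%Z.
  have : (p %| 2 * b * b)%Z.
    have -> : 2 * b * b = (p ^ s)%N%:Z - a * a by rewrite -ab; ring.
    by rewrite rpredB ?dvdz_mull // dvdzE /= dvdn_exp.
  rewrite dvdzE !abszM !Euclid_dvdM // -orbA orbb => /orP[|//].
  by rewrite dvdn_prime2 // absz_nat => /eqP h; have := p_odd; rewrite h.
have castF (n : int) : (p %| n)%Z -> n%:~R = 0 :> F.
  move=> /dvdzP[k ->]; rewrite rmorphM /=.
  by move: pch => /andP[_ /eqP h]; rewrite -[p%:~R]/(p%:R) h mulr0.
have [t qt] : exists t, (p ^ s = (8 * t).+1)%N.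
  exists (p ^ s %/ 8)%N; rewrite {1}(divn_eq (p ^ s) 8) exp_even_mod8 ?s_even //.
  by rewrite addn1 mulnC.
have t0 : (0 < t)%N.
  by rewrite lt0n; apply/eqP => t0; have := finNzRing_gt1 F; rewrite cardF qt t0.
have qF : #|F| = (8 * t).+1 by rewrite cardF.
(* This root selects a prime above p at which the reduction is informative: with g^t or g^(3t) the
   polynomial would have degree at most 6t < q - 1 and its sum would vanish. *)
pose v := g ^+ (5 * t).
have v4 : v ^+ 4 = -1.
  have h : (g ^+ (4 * t)) = -1.
    by rewrite -gen_half qF /=; congr (_ ^+ _); clear; lia.
  rewrite /v -exprM (_ : 5 * t * 4 = 4 * t * 5)%N; last by clear; lia.
  by rewrite exprM h; ring.
have := sum_eighth_root v4 c1 c2 c3.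
rewrite -/a -/b !castF // mul0r addr0 => /eqP.
have -> : \sum_(x | P x) v ^+ e x = \sum_(x : F) (x * (1 - x)) ^+ (5 * t).
  rewrite big_mkcond; apply: eq_bigr => x _; case: ifP => Pxx.
    by rewrite /v -exprM mulnC exprM dlogK // Px.
  rewrite (_ : x * (1 - x) = 0) ?expr0n ?muln_eq0 ?(gtn_eqF t0) //.
  by apply/eqP; rewrite mulf_eq0; move: Pxx => /= /negbT; rewrite negb_and !negbK.
rewrite sum_symmetric_powers // mulNr oppr_eq0 mulf_eq0 signr_eq0 /=.
rewrite -(dvdn_pcharf pch) => d.
by have := bin_five_three_eighths p_pr p8 s_even qt; rewrite d.
Qed.

Lemma quad_inj (a b c d : int) :
  a%:~R + b%:~R * sqrtm2 = c%:~R + d%:~R * sqrtm2 -> a = c /\ b = d.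
Proof.
move=> h; have /(congr1 (fun x => x * x^* )) :
    (a - c)%:~R + (b - d)%:~R * sqrtm2 = 0%:~R + 0%:~R * sqrtm2.
  rewrite !rmorphB /= mulrBl addrACA h; ring.
rewrite !quad_norm => /intr_inj; clear; move=> h.
have b0 : b - d = 0 by nia.
by rewrite b0 in h; nia.
Qed.

Lemma quad_sqr (a b : int) : (a%:~R + b%:~R * sqrtm2) ^+ 2
  = (a ^+ 2 - 2 * b ^+ 2)%:~R + (2 * a * b)%:~R * sqrtm2.
Proof.
rewrite rmorphB !rmorphM /=.
have -> : (a%:~R + b%:~R * sqrtm2) ^+ 2
  = a%:~R ^+ 2 + b%:~R ^+ 2 * sqrtm2 ^+ 2 + 2 * a%:~R * b%:~R * sqrtm2 by ring.
by rewrite sqrtm2_sqr; ring.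
Qed.

Lemma quadZ (c a b : int) :
  c%:~R * (a%:~R + b%:~R * sqrtm2) = (c * a)%:~R + (c * b)%:~R * sqrtm2.
Proof. by rewrite !rmorphM /= mulrDr mulrA. Qed.

(** * Determination of the Gauss sums of order 2^r *)

Lemma chi_opp1_index r : (0 < r <= M)%N ->
  (chi (2 ^ (M - r)) (-1) == 1) = (2 ^ r.+1 %| p ^ s - 1)%N.
Proof.
move=> rM; rewrite chi_opp1 -(prim_order_dvd zP).
have -> : (2 ^ M = 2 ^ (M - r) * 2 ^ r)%N by rewrite -expnD subnK //; lia.
rewrite dvdn_pmul2l ?expn_gt0 // -(@dvdn_pmul2r 2) // -expnSr muln2.
by rewrite -card_pred_half cardF subn1.
Qed.

(* In the recursion below the Jacobi sum takes the place of G 2, with A 2 and B 2. *)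
Definition Hs (r : nat) : algC := if r == 2%N then jac else G r.

Lemma Hs_sqr r : (2 <= r < M)%N -> G r.+1 ^+ 2 = - (p ^ s./2)%:R * Hs r.
Proof.
move=> rM; rewrite /Hs; case: eqP => [->|r2].
  by rewrite jac_gauss G2_G1 G1_value mulrC.
by rewrite G_sqr ?G1_value /= 1?mulrC //; lia.
Qed.

Lemma Ks_gt0 r : (1 <= r < M)%N -> (0 < Ks r)%N.
Proof.
move=> rM; have := KsK rM; case: (Ks r) => // s0.
by have := finNzRing_gt1 F; rewrite cardF s0 muln0.
Qed.

(* -sqrt(q) H_r is the square of the next Gauss sum, an element of Z[sqrt(-2)]
   times -p or a square root of -p; comparing real parts modulo 4 fixes the sign. *)
Lemma Hs_sign r (a b eps : int) : (2 <= r < M)%N -> eps = 1 \/ eps = -1 ->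
  Hs r = (cs r)%:R * (eps%:~R * (a%:~R + b%:~R * sqrtm2)) ->
  (exists k, a = 4 * k - 1) -> eps = 1.
Proof.
move=> rM e1 hE [k ak].
have rM' : (0 < r.+1 <= M)%N by lia.
have sq := Hs_sqr rM; rewrite hE in sq.
have [u [v E]] := @trace_one_sum_quad r.+1 ltac:(lia).
have nrm := G_norm rM'.
have rhsE : G r.+1 ^+ 2 = (- ((p ^ (s - Ks r))%N%:Z * eps * a))%:~R
    + (- ((p ^ (s - Ks r))%N%:Z * eps * b))%:~R * sqrtm2.
  rewrite sq -cs_prod // PoszM !rmorphN !rmorphM /= -!pmulrn; ring.
have pK : (p ^ s %/ 8 * 8 + 1 = p ^ s)%N.
  by rewrite [RHS](divn_eq _ 8) exp_even_mod8 ?s_even.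
(* The character of order 2^(r+1) is 1 at -1 iff 2^(r+2) divides q - 1, iff 2^r divides s, iff
   [Ks r] is even. The same parity decides whether p^(s - K_r) is 3 or 1 mod 8, and the two effects
   compensate. *)
have [oK|eK] := boolP (odd (Ks r)).
- have c1 : chi (2 ^ (M - r.+1)) (-1) != 1.
    rewrite chi_opp1_index //; have [i ri] : exists i, r = i.+1 by exists r.-1; lia.
    rewrite ri exp_pred_dvd_two_pow // -ri (@KsK r) ?ri; last by lia.
    rewrite subn1 /= expnSr dvdn_pmul2l ?expn_gt0 // -ri dvdn2 oK //.
  have [gam g2 gE] := Gs_trace_one_odd c1.
  have gn : gam * gam^* = p%:R.
    by rewrite -normCK -normrX g2 normrN normr_nat.
  rewrite /G gE E in nrm rhsE.
  have nI : p%:Z * (u ^+ 2 + 2 * v ^+ 2) = (p ^ s)%N.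
    apply: (@intr_inj algC); rewrite rmorphM /= -quad_norm -[RHS]nrm rmorphM /=.
    by rewrite mulrACA gn.
  move: rhsE; rewrite exprMn g2 quad_sqr.
  rewrite (_ : - p%:R = (- p%:Z)%:~R :> algC); last by rewrite rmorphN.
  rewrite quadZ => /quad_inj[h _].
  have pr : (p ^ (s - Ks r) %/ 8 * 8 + 3 = p ^ (s - Ks r))%N.
    rewrite [RHS](divn_eq _ 8) exp_odd_mod8 // oddB ?(negPf s_even) ?oK //.
    have := @Ks_le r rM; have := s_halfK; clear; lia.
  move: h nI; rewrite -pr -pK; case: e1 => // ->; rewrite ak.
  move: (p ^ s %/ 8)%N (p ^ (s - Ks r) %/ 8)%N => x y; clear.
  rewrite !PoszD !PoszM => h nI.
  have : - (p%:Z * (u ^+ 2 + 2 * v ^+ 2)) + 4 * (p%:Z * v ^+ 2)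
    = (8 * y%:Z + 3) * (4 * k - 1) by lia.
  by rewrite nI; lia.
have c1 : chi (2 ^ (M - r.+1)) (-1) = 1.
  apply/eqP; rewrite chi_opp1_index //.
  have [i ri] : exists i, r = i.+1 by exists r.-1; lia.
  rewrite ri exp_pred_dvd_two_pow // -ri (@KsK r) ?ri; last by lia.
  by rewrite subn1 /= expnSr dvdn_pmul2l ?expn_gt0 // -ri dvdn2.
have gE := Gs_trace_one (two_pow_index_ndvd rM') c1.
rewrite /G gE E in nrm rhsE.
have nI : p%:Z ^+ 2 * (u ^+ 2 + 2 * v ^+ 2) = (p ^ s)%N.
  apply: (@intr_inj algC); rewrite rmorphM rmorphXn /= -quad_norm -[RHS]nrm rmorphM /=.
  by rewrite rmorphN rmorph_nat -pmulrn; ring.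
move: rhsE; rewrite exprMn sqrrN quad_sqr.
rewrite (_ : p%:R ^+ 2 = (p%:Z ^+ 2)%:~R :> algC); last by rewrite rmorphXn.
rewrite quadZ => /quad_inj[h _].
have pr : (p ^ (s - Ks r) %/ 8 * 8 + 1 = p ^ (s - Ks r))%N.
  rewrite [RHS](divn_eq _ 8) exp_even_mod8 // oddB ?(negPf s_even) ?eK //.
  have := @Ks_le r rM; have := s_halfK; clear; lia.
move: h nI; rewrite -pr -pK; case: e1 => // ->; rewrite ak.
move: (p ^ s %/ 8)%N (p ^ (s - Ks r) %/ 8)%N => x y; clear.
rewrite !PoszD !PoszM => h nI.
have : p%:Z ^+ 2 * (u ^+ 2 + 2 * v ^+ 2) - 4 * (p%:Z ^+ 2 * v ^+ 2)
    = (8 * y%:Z + 1) * (4 * k - 1) by lia.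
by rewrite nI; lia.
Qed.

(** Induction on r. The square of A_(r+1) + B_(r+1) sqrt(-2) has the norm of A_r + B_r sqrt(-2), so
    uniqueness identifies them up to signs; the recursion then gives G_(r+1) up to sign, and
    [Hs_sign] the sign. The sign of B_r remains free. *)
Lemma Hs_value (A B : nat -> int) : (forall r, (2 <= r < M)%N ->
    [/\ (p ^ (s %/ 2 ^ (r - 2)))%N%:Z = A r ^+ 2 + 2 * B r ^+ 2,
        exists k, A r = 4 * k - 1 & ~~ (p %| A r)%Z]) ->
  forall r, (2 <= r < M)%N -> exists2 e : int, e = 1 \/ e = -1 &
    Hs r = (cs r)%:R * ((A r)%:~R + (e * B r)%:~R * sqrtm2).
Proof.
move=> hAB.
have flip (x y : int) : x = y \/ x = - y -> exists2 e : int, e = 1 \/ e = -1 & x = e * y.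
  by case=> ->; [exists 1 | exists (-1)]; rewrite ?mul1r ?mulN1r //; [left|right].
have sgn r (a b eps : int) : (2 <= r < M)%N -> eps = 1 \/ eps = -1 ->
    (exists k, a = 4 * k - 1) ->
    Hs r = (cs r)%:R * (eps%:~R * (a%:~R + b%:~R * sqrtm2)) ->
    Hs r = (cs r)%:R * (a%:~R + b%:~R * sqrtm2).
  move=> rM e1 ma hE; have e := Hs_sign rM e1 hE ma.
  by rewrite hE e mul1r.
elim=> [//|r IHr] rM.
have [nA mA pA] := hAB _ rM.
have K0 : (0 < Ks r.+1)%N by apply: Ks_gt0; lia.
have [r1|r1] := eqVneq r 1%N.
  rewrite {r IHr}r1 in rM K0 nA mA pA *.
  have [a [b [jE nE pa]]] := jac_quad.
  rewrite subnn divn1 in nA; have s0 : (0 < s)%N by rewrite (leq_trans K0) // leq_div.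
  have [/flip[e1 he1 ha] /flip[e2 he2 hb]] :=
    sqr_plus_two_sqr_unique p_pr p_odd s0 (esym nA) nE pA pa.
  exists (e1 * e2); first by case: he1 he2 => -> [] ->; [left|right|right|left].
  apply: (sgn _ _ _ e1) => //; rewrite /Hs eqxx jE /gauss_scale quot_exp2 subnn expn0 mul1r.
  rewrite quadZ ha hb mulrA mulrA (_ : e1 * e1 = 1) ?mul1r //.
  by case: he1 => ->.
have r2 : (2 <= r)%N by lia.
have rM' : (r.+1 < M)%N by lia.
have rM0 : (2 <= r < M)%N by rewrite r2 ltnW.
have [e he hE] := IHr rM0; have [nA' mA' pA'] := hAB r rM0.
rewrite (Ks_exponent rM) in nA; rewrite (Ks_exponent rM0) in nA'.
have KS := KsS (ltnW r2) rM'.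
set a := A r.+1 in nA mA pA *; set b := B r.+1 in nA *.
have nX : (a ^+ 2 - 2 * b ^+ 2) ^+ 2 + 2 * (2 * a * b) ^+ 2 = (p ^ (2 * Ks r))%N.
  transitivity ((a ^+ 2 + 2 * b ^+ 2) ^+ 2); first by ring.
  by rewrite -nA expr2 -PoszM mulnn -expnM mulnC KS.
have pX : ~~ (p %| a ^+ 2 - 2 * b ^+ 2)%Z.
  apply: contra pA => d; have : (p %| 2 * a * a)%Z.
    have -> : 2 * a * a = (a ^+ 2 - 2 * b ^+ 2) + (p ^ (2 * Ks r.+1))%N%:Z.
      by rewrite nA; ring.
    by apply: rpredD => //; rewrite dvdzE /= dvdn_exp // muln_gt0.
  rewrite !dvdzE !abszM !Euclid_dvdM // -orbA orbb => /orP[|//].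
  by rewrite dvdn_prime2 // absz_nat => /eqP h; have := p_odd; rewrite h.
have K0' : (0 < 2 * Ks r)%N by rewrite KS !muln_gt0 K0.
have [hA /flip[e3 he3 hB]] :=
  sqr_plus_two_sqr_unique p_pr p_odd K0' nX (esym nA') pX pA'.
(* a^2 - 2b^2 = (a^2 + 2b^2) - 4b^2 is 1 mod 4, the norm being an even power of p, whereas A_r is -1
   mod 4. This minus sign absorbs the one in the recursion. *)
have {}hA : A r = - (a ^+ 2 - 2 * b ^+ 2).
  case: hA => // hA; have [k mk] := mA'.
  have : (p ^ (2 * Ks r.+1) %/ 8 * 8 + 1 = p ^ (2 * Ks r.+1))%N.
    by rewrite [RHS](divn_eq _ 8) exp_even_mod8 // mul2n odd_double.
  move: nA hA; rewrite mk; move: (p ^ _)%N (_ %/ _)%N => x y.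
  by move: (a ^+ 2) (b ^+ 2); clear; lia.
pose e4 := - (e * e3).
have e4e : e4 = 1 \/ e4 = -1 by rewrite /e4; case: he he3 => -> [] ->; auto.
have sq : G r.+1 ^+ 2 = ((cs r.+1)%:R * (a%:~R + (e4 * b)%:~R * sqrtm2)) ^+ 2.
  rewrite Hs_sqr ?hE //.
  rewrite exprMn -natrX -mulnn -cs_sqr // natrM quad_sqr -!mulrA mulNr -mulrN -mulrN.
  congr (_ * (_ * _)).
  rewrite (_ : (e4 * b) ^+ 2 = b ^+ 2); last first.
    by rewrite exprMn; case: e4e => ->; rewrite ?sqrrN expr1n mul1r.
  have -> : 2 * (a * (e4 * b)) = - (e * (e3 * (2 * a * b))) by rewrite /e4; ring.
  by rewrite hA hB !(rmorphN, mulNr) /= opprD opprK.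
exists e4 => //.
have HG : Hs r.+1 = G r.+1 by rewrite /Hs eqSS (negPf r1).
have /eqP := sq; rewrite eqf_sqr => /orP[]/eqP h; rewrite HG; first exact: h.
rewrite -HG; apply: (sgn _ _ _ (-1)) => //; first by right.
by rewrite HG h -mulrN mulN1r.
Qed.

(** * Values of the exponential sums, order by order *)

Definition dual_root r k : algC := (z ^+ (2 ^ (M - r) * k))^*.

(** The characters of order dividing 2^r; 1 + [Us m k] is the exponential sum S(g^k), the 1 coming
    from x = 0. *)
Definition Us r k : algC :=
  \sum_(j < 2 ^ r) (chi (j * 2 ^ (M - r)) (g ^+ k))^* * Gs (j * 2 ^ (M - r)).

(** The contribution to [Us] of the characters of exact order 2^r, i.e. of odd multiples of the
    index 2^(M-r). *)
Definition Ts r k : algC :=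
  \sum_(i < 2 ^ r.-1)
    dual_root r k ^+ (2 * i).+1 * Gs ((2 * i).+1 * 2 ^ (M - r)).

Lemma chi_dual_root j r k :
  (chi (j * 2 ^ (M - r)) (g ^+ k))^* = dual_root r k ^+ j.
Proof. by rewrite chi_gen /dual_root -rmorphXn /= -exprM; congr ((_ ^+ _)^* ); lia. Qed.

Lemma Us0 k : Us 0 k = -1.
Proof. by rewrite /Us expn0 big_ord1 /= mul0n Gs0 chi_gen mul0n rmorph1 mul1r. Qed.

Lemma UsS r k : (r < M)%N -> Us r.+1 k = Us r k + Ts r.+1 k.
Proof.
move=> rM; rewrite /Us /Ts expnS.
rewrite (sum_double (fun j => (chi (j * 2 ^ (M - r.+1)) (g ^+ k))^* *
   Gs (j * 2 ^ (M - r.+1)))); congr (_ + _); apply: eq_bigr => i _.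
  have -> : (2 * i * 2 ^ (M - r.+1) = i * 2 ^ (M - r))%N.
    by rewrite mulnAC mulnC -expnS; congr (_ * 2 ^ _)%N; lia.
  by [].
by rewrite chi_dual_root.
Qed.

(** An odd j that is 1 or 3 mod 8 is a power of p modulo 2^r; otherwise -j is. *)
Lemma Gs_odd_index r j : (3 <= r < M)%N -> odd j ->
  Gs (j * 2 ^ (M - r)) = if (j %% 8)%N \in [:: 1%N; 3] then G r else (G r)^*.
Proof.
move=> rM oj; have [n rn] : exists n, r = n.+3 by exists (r - 3)%N; lia.
have eM : (2 ^ r * 2 ^ (M - r) = 2 ^ M)%N by rewrite -expnD subnKC //; lia.
have key i : (i %% 8)%N \in [:: 1%N; 3] -> Gs (i * 2 ^ (M - r)) = G r.
  move=> i8; have [e he] := odd_residue_is_power p8 n i8.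
  transitivity (Gs (2 ^ (M - r) * p ^ e)); last exact: Gs_frob.
  apply: Gs_eqmod; rewrite -eM.
  by rewrite [(2 ^ (M - r) * _)%N]mulnC -!muln_modl [X in (2 ^ X)%N]rn he.
case: ifP => [|nj]; first exact: key.
rewrite -(@key (j * (2 ^ r - 1))%N); last first.
  have e8 : ((2 ^ r - 1) %% 8 = 7)%N.
    rewrite rn (_ : 2 ^ n.+3 - 1 = (2 ^ n - 1) * 8 + 7)%N; first by rewrite modnMDl.
    by rewrite !expnS; have := expn_gt0 2 n; move: (2 ^ n)%N; clear; lia.
  have j8 : odd (j %% 8) by rewrite odd_mod.
  rewrite -modnMm e8; move: nj j8 (ltn_pmod j (isT : 0 < 8)%N).
  by move: (j %% 8)%N; do 8 case=> //.
rewrite (@Gs_conj _ (j * 2 ^ (M - r))).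
  rewrite chi_opp1_even ?mul1r // oddM oddX /=.
  by rewrite (_ : (M - r == 0)%N = false) ?andbF //; lia.
rewrite -mulnDl -{2}(muln1 j) -mulnDr subnK ?expn_gt0 // -mulnA eM.
exact: dvdn_mull.
Qed.

(** The odd indices 8i + 1, 3, 5, 7 are separated by three parity splittings, leaving a geometric
    series in x^8. It vanishes unless x^8 = 1, so unless 2^n divides k. *)
Lemma Ts_ge3 n k (x := dual_root n.+3 k) : (n.+3 < M)%N ->
  Ts n.+3 k = (\sum_(i < 2 ^ n) (x ^+ 8) ^+ i)
    * ((x + x ^+ 3) * G n.+3 + (x ^+ 5 + x ^+ 7) * (G n.+3)^* ).
Proof.
move=> nM; rewrite /Ts -/x /= !expnS.
pose f i := x ^+ (2 * i).+1 * Gs ((2 * i).+1 * 2 ^ (M - n.+3)).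
rewrite (sum_double f) (sum_double (fun i => f (2 * i)%N)).
rewrite (sum_double (fun i => f (2 * i).+1)) -!big_split /= mulr_suml.
have n3 : (3 <= n.+3 < M)%N by rewrite nM.
apply: eq_bigr => i _; rewrite /f !Gs_odd_index //=; try lia.
have r1 : ((2 * (2 * (2 * i))).+1 %% 8 = 1)%N by lia.
have r5 : ((2 * (2 * (2 * i).+1)).+1 %% 8 = 5)%N by lia.
have r3 : ((2 * (2 * (2 * i)).+1).+1 %% 8 = 3)%N by lia.
have r7 : ((2 * (2 * (2 * i).+1).+1).+1 %% 8 = 7)%N by lia.
rewrite r1 r3 r5 r7 /=.
have e c : x ^+ (8 * i + c) = (x ^+ 8) ^+ i * x ^+ c by rewrite exprD exprM.
rewrite (_ : (2 * (2 * (2 * i))).+1 = 8 * i + 1)%N; last by lia.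
rewrite (_ : (2 * (2 * (2 * i).+1)).+1 = 8 * i + 5)%N; last by lia.
rewrite (_ : (2 * (2 * (2 * i)).+1).+1 = 8 * i + 3)%N; last by lia.
rewrite (_ : (2 * (2 * (2 * i).+1).+1).+1 = 8 * i + 7)%N; last by lia.
by rewrite !e expr1; ring.
Qed.

Lemma Ts_zero n k : (n.+3 < M)%N -> ~~ (2 ^ n %| k)%N -> Ts n.+3 k = 0.
Proof.
move=> nM nk; rewrite Ts_ge3 //; set x := dual_root _ _.
have e8 : x ^+ 8 = (z ^+ (2 ^ (M - n) * k))^*.
  rewrite /x /dual_root -rmorphXn /= -exprM; congr ((_ ^+ _)^* ).
  rewrite mulnAC (_ : 8 = 2 ^ 3)%N // -expnD; congr (2 ^ _ * _)%N; lia.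
have x8 : x ^+ 8 != 1.
  rewrite e8 -(inj_eq (inv_inj conjCK)) conjCK rmorph1 -(prim_order_dvd zP).
  rewrite (_ : 2 ^ M = 2 ^ (M - n) * 2 ^ n)%N; last by rewrite -expnD subnK //; lia.
  by rewrite dvdn_pmul2l ?expn_gt0.
have : (x ^+ 8) ^+ (2 ^ n) - 1 = 0.
  rewrite e8 -rmorphXn /= -exprM mulnAC -expnD subnK; last by lia.
  by rewrite exprM (prim_expr_order zP) expr1n rmorph1 subrr.
rewrite subrX1 => /eqP; rewrite mulf_eq0 subr_eq0 (negPf x8) /= => /eqP->.
by rewrite mul0r.
Qed.

Section Values.
Variables al be : nat -> int.
Hypothesis al1 : al 1%N = - (p ^ s./2)%N%:Z.
Hypothesis al2 : al 2%N = - (p ^ s./2)%N%:Z.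
Hypothesis GE : forall r, (3 <= r < M)%N ->
  G r = (al r)%:~R + (be r)%:~R * sqrtm2.

Lemma G_conjE r : (3 <= r < M)%N -> (G r)^* = (al r)%:~R - (be r)%:~R * sqrtm2.
Proof.
by move=> r3; rewrite GE // rmorphD rmorphM /= !rmorph_int sqrtm2_conj mulrN.
Qed.

(** If x^4 = 1 the bracket of [Ts_ge3] is (x + x^3)(G + conj G), which loses the coefficient of
    sqrt(-2). Dividing by 2 lets the formula cover r = 1 as well, where x^3 = x and there is a
    single term. *)
Lemma Ts_real r k : (1 <= r < M)%N -> dual_root r k ^+ 4 = 1 ->
  Ts r k = (2 ^+ r.-1 * al r)%:~R * (dual_root r k + dual_root r k ^+ 3) / 2.
Proof.
set x := dual_root r k; move=> rM x4; rewrite !rmorphM rmorphXn /=.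
have half (y : algC) : y = y * 2 / 2 by rewrite mulfK // pnatr_eq0.
case: r @x rM x4 => [|[|[|n]]] // x rM x4.
- have G1E : G 1 = (al 1%N)%:~R by rewrite G1_value al1 rmorphN.
  rewrite /Ts expn0 big_ord1 /= muln0 expr1 mul1n -/(G 1) -/x G1E mul1r.
  have x2 : x ^+ 2 = 1.
    rewrite /x /dual_root -rmorphXn /= -exprM mulnAC -expnSr.
    rewrite (_ : (M - 1).+1 = M); last by lia.
    by rewrite exprM (prim_expr_order zP) expr1n rmorph1.
  rewrite (exprS x 2) x2 [LHS]half; ring.
- have G2E : G 2 = (al 2%N)%:~R by rewrite G2_G1 G1_value al2 rmorphN.
  rewrite /Ts expn1 !big_ord_recl big_ord0 /= !muln0 expr1 mul1n addr0 -/(G 2).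
  have -> : Gs ((2 * bump 0 0).+1 * 2 ^ (M - 2)) = G 2.
    rewrite [RHS]/G -(Gs_frob (2 ^ (M - 2)) 1) expn1 mulnC; apply: Gs_eqmod.
    by rewrite frob_index.
  rewrite G2E -/x expr1 [LHS]half.
  by rewrite -[(2 * bump 0 0).+1]/3%N; ring.
rewrite Ts_ge3 // -/x (_ : x ^+ 8 = 1); last by rewrite (exprM x 4 2) x4 expr1n.
rewrite (exprD x 4 1) (exprD x 4 3) x4 expr1 !mul1r G_conjE // GE //.
under eq_bigr do rewrite expr1n.
rewrite sumr_const card_ord [LHS]half /= !exprS -natrX; ring.
Qed.

Lemma Ts_low r k : (1 <= r < M)%N -> (2 ^ r %| k)%N -> Ts r k = (2 ^+ r.-1 * al r)%:~R.
Proof.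
move=> rM /dvdnP[k' kk].
have x1 : dual_root r k = 1.
  rewrite /dual_root kk mulnCA -expnD subnK; last by lia.
  by rewrite mulnC exprM (prim_expr_order zP) expr1n rmorph1.
rewrite Ts_real ?x1 ?expr1n //.
by rewrite (_ : (1 : algC) + 1 = 2) ?mulfK ?pnatr_eq0.
Qed.

Lemma dual_root_half r k : (1 <= r < M)%N -> odd k -> dual_root r (2 ^ r.-1 * k) = -1.
Proof.
move=> rM ok; rewrite /dual_root mulnA -expnD.
have -> : (M - r + r.-1 = M.-1)%N by lia.
by rewrite exprM z_half -signr_odd ok rmorphN rmorph1.
Qed.

Lemma Ts_half r k : (1 <= r < M)%N -> odd k ->
  Ts r (2 ^ r.-1 * k) = (- (2 ^+ r.-1 * al r))%:~R.
Proof.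
move=> rM ok; have x1 := dual_root_half rM ok.
have N14 : (-1 : algC) ^+ 4 = 1 by ring.
have N13 : (-1 : algC) + (-1) ^+ 3 = -1 * 2 by ring.
by rewrite Ts_real ?x1 // N13 mulrA mulfK ?pnatr_eq0 // mulrN1 rmorphN.
Qed.

Lemma Ts_quarter r k : (2 <= r < M)%N -> odd k -> Ts r (2 ^ r.-2 * k) = 0.
Proof.
move=> rM ok; have x2 : dual_root r (2 ^ r.-2 * k) ^+ 2 = -1.
  rewrite /dual_root -rmorphXn /= -exprM mulnA -expnD mulnAC -expnSr.
  have -> : ((M - r + r.-2).+1 = M.-1)%N by lia.
  by rewrite exprM z_half -signr_odd ok rmorphN rmorph1.
rewrite Ts_real; last 2 first.
- by lia.
- by rewrite (exprM _ 2 2) x2 sqrrN expr1n.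
by rewrite exprS x2 mulrN1 subrr mulr0 mul0r.
Qed.

(** For odd u this is the Jacobi symbol (-2/u). *)
Definition sg (u : nat) : int := if (u %% 8)%N \in [:: 1%N; 3] then 1 else -1.

(** Here x is a primitive eighth root of unity, so x^5 + x^7 = -(x + x^3), and (x + x^3)(G - conj G)
    keeps only the coefficient of sqrt(-2). *)
Lemma Ts_eighth r k : (3 <= r < M)%N -> odd k ->
  Ts r (2 ^ (r - 3) * k) = (sg k * 2 ^+ r.-1 * be r)%:~R.
Proof.
case: r => [|[|[|n]]] // rM ok; rewrite (_ : n.+3 - 3 = n)%N; last by lia.
rewrite Ts_ge3 // G_conjE // GE //.
pose y := zeta8^*; have xE : dual_root n.+3 (2 ^ n * k) = y ^+ k.
  rewrite /dual_root /y /zeta8 mulnA -expnD -rmorphXn /= -exprM.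
  by congr ((_ ^+ (2 ^ _ * _))^* ); lia.
have y4 : y ^+ 4 = -1.
  by rewrite /y -rmorphXn zeta8_4 rmorphN rmorph1.
have yw : y + y ^+ 3 = - sqrtm2.
  rewrite -sqrtm2_conj /sqrtm2 /y rmorphD /=; congr (_ + _).
  by rewrite !exprS expr0 !mulr1 !rmorphM.
have y8 : y ^+ 8 = 1 by rewrite (exprM y 4 2) y4 sqrrN expr1n.
rewrite xE -(exprAC y 8 k) y8 expr1n.
under eq_bigr do rewrite expr1n.
rewrite sumr_const card_ord.
have w2 := sqrtm2_sqr.
have p1 : (y ^+ 5 = - y) by rewrite (exprD y 4 1) y4 mulN1r.
have p2 : (y ^+ 7 = - y ^+ 3) by rewrite (exprD y 4 3) y4 mulN1r.
have red i : y ^+ i = y ^+ (i %% 8) by rewrite (GRing.expr_mod i y8).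
have main (e : int) (u v : algC) : u = (- e)%:~R * sqrtm2 -> v = e%:~R * sqrtm2 ->
   (2 ^ n)%:R * (u * ((al n.+3)%:~R + (be n.+3)%:~R * sqrtm2)
      + v * ((al n.+3)%:~R - (be n.+3)%:~R * sqrtm2))
   = (e * 2 ^+ n.+2 * be n.+3)%:~R.
  have P : (2 ^+ n.+2 : int)%:~R = 4 * (2 ^ n)%:R :> algC.
    by rewrite rmorphXn /= !exprS natrX; ring.
  move=> -> ->; move: (2 ^+ n.+2) P => T P; rewrite !rmorphM rmorphN /= P.
  transitivity ((2 ^ n)%:R * (e%:~R * (- 2 * (be n.+3)%:~R * sqrtm2 ^+ 2)) : algC).
    by ring.
  by rewrite w2; ring.
have -> : (n.+3).-1 = n.+2 by [].
have sE : sqrtm2 = - (y + y ^+ 3) by rewrite yw opprK.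
have pows : y ^+ k + (y ^+ k) ^+ 3 = (- sg k)%:~R * sqrtm2 /\
            (y ^+ k) ^+ 5 + (y ^+ k) ^+ 7 = (sg k)%:~R * sqrtm2.
  rewrite -!exprM [y ^+ k]red [y ^+ (k * 3)]red [y ^+ (k * 5)]red [y ^+ (k * 7)]red.
  rewrite -(modnMml k 3) -(modnMml k 5) -(modnMml k 7) /sg sE.
  have : odd (k %% 8) by rewrite odd_mod.
  have := ltn_pmod k (isT : 0 < 8)%N.
  case: (k %% 8)%N => [|[|[|[|[|[|[|[|c]]]]]]]] // _ _;
    by rewrite !inE /= ?p1 ?p2; split; ring.
by case: pows => h1 h2; exact: main h1 h2.
Qed.

Definition Lv (t : nat) : int := \sum_(1 <= r < t.+1) 2 ^+ r.-1 * al r.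

Lemma Us_low r k : (r < M)%N -> (2 ^ r %| k)%N -> Us r k = -1 + (Lv r)%:~R.
Proof.
elim: r => [|r IHr] rM d; first by rewrite Us0 /Lv big_geq // addr0.
rewrite UsS ?(ltnW rM) // IHr ?(ltnW rM) //; last first.
  by apply: dvdn_trans d; rewrite dvdn_exp2l.
by rewrite Ts_low // /Lv [in RHS]big_nat_recr //= rmorphD addrA.
Qed.

(* The exponential sum at g^(2^t u), u odd. *)
Definition Sv (m t u : nat) : int := Lv t - 2 ^+ t * al t.+1
  + (if (t + 3 <= m)%N then sg u * 2 ^+ t.+2 * be t.+3 else 0).

Lemma Sv_small m t u : (m < t + 3)%N -> Sv m t u = Lv t - 2 ^+ t * al t.+1.
Proof. by move=> h; rewrite /Sv leqNgt h addr0. Qed.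

Lemma Sv_large m t u : (t + 3 <= m)%N ->
  Sv m t u = Lv t - 2 ^+ t * al t.+1 + sg u * 2 ^+ t.+2 * be t.+3.
Proof. by move=> h; rewrite /Sv h. Qed.

Lemma Us_value m t u : (t < m)%N -> (m < M)%N -> odd u ->
  1 + Us m (2 ^ t * u) = (Sv m t u)%:~R.
Proof.
move=> tm mM ou; have [d md] : exists d, m = (t.+1 + d)%N by exists (m - t.+1)%N; lia.
move: mM; rewrite {tm}md; elim: d => [|d IHd] mM.
  rewrite addn0 in mM *; rewrite UsS ?(ltnW mM) // Us_low ?(ltnW mM) //; last first.
    exact: dvdn_mulr.
  rewrite (@Ts_half t.+1) // Sv_small; last by clear; lia.
  by rewrite rmorphB rmorphN /= addrA addrA subrr add0r.
rewrite addnS UsS ?(ltnW mM) //; last by rewrite -addnS ltnW.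
rewrite addrA IHd; last by rewrite (leq_trans _ mM) // ltnS leq_add2l.
(* The order just added is 2^(t+2), which contributes 0, then 2^(t+3), which brings in [be], then
   higher ones, whose geometric series vanish. *)
case: d mM {IHd} => [|[|d]] mM.
- rewrite addn0 (@Ts_quarter t.+2) //; last by move: mM; rewrite addn1.
  by rewrite addr0 !Sv_small //; clear; lia.
- have -> : (t.+1 + 1).+1 = t.+3 by rewrite addn1.
  have -> : (2 ^ t * u = 2 ^ (t.+3 - 3) * u)%N by rewrite -[t.+3]addn3 addnK.
  rewrite Ts_eighth //; last by move: mM; rewrite addn2.
  rewrite Sv_small; last by clear; lia.
  by rewrite Sv_large ?rmorphD //; clear; lia.
have -> : (t.+1 + d.+2).+1 = (t + d).+1.+3 by clear; lia.
rewrite Ts_zero.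
- by rewrite addr0 !Sv_large //; clear; lia.
- by move: mM; clear; lia.
rewrite -addnS expnD dvdn_pmul2l ?expn_gt0 // expnS.
by apply/negP => /(dvdn_trans (dvdn_mulr _ (dvdnn 2))); rewrite dvdn2 ou.
Qed.

(** * From exponential sums to the number of solutions *)

Lemma sum_power_map r (f : F -> algC) : (r <= M)%N ->
  \sum_(x | x != 0) f (x ^+ (2 ^ r))
  = (2 ^ r)%:R * \sum_(x | (x != 0) && (chi (2 ^ (M - r)) x == 1)) f x.
Proof.
move=> rM; have /dvdnP[L qL] : (2 ^ r %| #|F|.-1)%N.
  by apply: dvdn_trans two_pow_dvd_order; rewrite dvdn_exp2l.
rewrite (sum_nonzero_gen gP) big_mkcondr (sum_nonzero_gen gP) -big_mkcond /=.
have cE i : (chi (2 ^ (M - r)) (g ^+ i) == 1) = (2 ^ r %| i)%N.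
  rewrite chi_gen -(prim_order_dvd zP).
  rewrite (_ : 2 ^ M = 2 ^ (M - r) * 2 ^ r)%N; last by rewrite -expnD subnK.
  by rewrite dvdn_pmul2l ?expn_gt0.
rewrite [X in _ = _ * X](eq_bigl (fun i : 'I__ => (2 ^ r %| i)%N)) => [|i]; last exact: cE.
rewrite -(big_mkord xpredT (fun i => f ((g ^+ i) ^+ (2 ^ r)))).
rewrite -(big_mkord (fun i => (2 ^ r %| i)%N) (fun i => f (g ^+ i))) qL.
have r0 : (0 < 2 ^ r)%N by rewrite expn_gt0.
rewrite !big_mkord (sum_multiples (fun i => f (g ^+ i)) L r0).
rewrite mulnC (@sum_periodic _ (fun i => f ((g ^+ i) ^+ (2 ^ r))) L).
  by rewrite mulr_natl; congr (_ *+ _); apply: eq_bigr => i _; rewrite exprM.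
by move=> i; rewrite -!exprM mulnDl -qL exprD (prim_expr_order gP) mulr1.
Qed.

Lemma exp_sum_value m k : (m <= M)%N ->
  \sum_x psi (g ^+ k * x ^+ (2 ^ m)) = 1 + Us m k.
Proof.
move=> mM; rewrite (bigD1 0) //= expr0n expn_eq0 /= mulr0.
rewrite (sum_power_map (fun y => psi (g ^+ k * y)) mM).
rewrite -coset_sum ?generatorX_neq0 //.
by case: psi_add_char => ->.
Qed.

Lemma Us_periodic m k : (m <= M)%N -> Us m (k + 2 ^ m) = Us m k.
Proof.
move=> mM; apply: eq_bigr => j _; congr (_^* * _).
rewrite !chi_gen -!mulnA; apply: zX_eqmod; apply: eqmodM.
by rewrite mulnDr -expnD subnK // modnDr.
Qed.

(** Orthogonality gives q N as the sum of S(a)^n over all a. The term a = 0 is q^n; for a = g^i the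
    value has period 2^m in i, so each class occurs (q-1)/2^m times. The factor 2^m is kept on the
    left to avoid this division. *)
Lemma diagonal_count m n : (m <= M)%N ->
  (2 ^ m)%:R * ((p ^ s)%:R *
    #|[set x : {ffun 'I_n -> F} | \sum_(i < n) x i ^+ (2 ^ m) == 0]|%:R
    - (p ^ s)%:R ^+ n)
  = ((p ^ s)%:R - 1) * \sum_(k < 2 ^ m) (1 + Us m k) ^+ n.
Proof.
move=> mM; have q0 := prim_order_gt0 gP.
case: (psi_add_char) => s0 sD _ _.
have psi_sum (a : F) (x : {ffun 'I_n -> F}) :
   psi (a * \sum_i x i ^+ (2 ^ m)) = \prod_i psi (a * x i ^+ (2 ^ m)).
  by rewrite mulr_sumr (big_morph _ sD s0).
have e1 : (p ^ s)%:R *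
    #|[set x : {ffun 'I_n -> F} | \sum_(i < n) x i ^+ (2 ^ m) == 0]|%:R
    = \sum_(a : F) (\sum_x psi (a * x ^+ (2 ^ m))) ^+ n.
  transitivity (\sum_(x : {ffun 'I_n -> F})
      \sum_a psi ((\sum_i x i ^+ (2 ^ m)) * a)).
    under eq_bigr do rewrite (sum_add_charM _ psi_add_char).
    rewrite -big_mkcond /= sumr_const cardF -[RHS]mulr_natr; congr (_ * _%:R).
    by apply: eq_card => x; rewrite !inE.
  rewrite exchange_big; apply: eq_bigr => a _.
  rewrite -[X in _ ^+ X](card_ord n) -prodr_const bigA_distr_bigA /=.
  by apply: eq_bigr => x _; rewrite mulrC psi_sum.
rewrite e1 (bigD1 0) //=.
have -> : \sum_x psi (0 * x ^+ (2 ^ m)) = (p ^ s)%:R.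
  under eq_bigr do rewrite mul0r s0.
  by rewrite sumr_const cardF.
rewrite addrC addrK (sum_nonzero_gen gP).
rewrite [in LHS](eq_bigr (fun i : 'I__ => (1 + Us m i) ^+ n)) => [|i _]; last first.
  by rewrite exp_sum_value.
have /dvdnP[L qL] : (2 ^ m %| #|F|.-1)%N.
  by apply: dvdn_trans two_pow_dvd_order; rewrite dvdn_exp2l.
rewrite -(big_mkord xpredT (fun i => (1 + Us m i) ^+ n)) qL big_mkord.
rewrite (@sum_periodic _ (fun i => (1 + Us m i) ^+ n) (2 ^ m)); last first.
  by move=> i; rewrite Us_periodic.
rewrite mulrnAr -mulrnAl -mulrnA mulnC -qL; congr (_ * _).
by rewrite cardF -subn1 natrB // expn_gt0 prime_gt0.
Qed.

Definition Xv (t : nat) : int := Lv t - 2 ^+ t * al t.+1.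
Definition Yv (t : nat) : int := 2 ^+ t.+2 * be t.+3.

Lemma sum_odd_part m t n : (t + 3 <= m)%N ->
  \sum_(i < 2 ^ (m - t.+1)) (Sv m t (2 * i).+1) ^+ n
  = 2 ^+ (m - t - 2) * ((Xv t + Yv t) ^+ n + (Xv t - Yv t) ^+ n).
Proof.
move=> tm; pose f i := Sv m t (2 * i).+1 ^+ n.
have -> : (2 ^ (m - t.+1) = 2 ^ (m - t - 3) * 4)%N.
  by rewrite (_ : 4 = 2 ^ 2)%N // -expnD; congr (2 ^ _)%N; move: tm; clear; lia.
have sgE i : Sv m t (2 * i).+1 = Xv t + sg (2 * i).+1 * Yv t.
  by rewrite Sv_large // -mulrA.
(* The sign has period 8 in u = 2i + 1, hence 4 in i, and a period u = 1, 3, 5, 7 has signs +, +, -,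
   -. *)
rewrite (@sum_periodic _ f 4); last first.
  move=> i; rewrite /f !sgE /sg (_ : (2 * (i + 4)).+1 = 1 * 8 + (2 * i).+1)%N.
    by rewrite modnMDl.
  by clear; lia.
rewrite !big_ord_recl big_ord0 /f !sgE /sg /= !mul1r !mulN1r addr0.
have -> : (m - t - 2 = (m - t - 3).+1)%N by move: tm; clear; lia.
by rewrite exprS -[LHS]mulr_natr natrX; ring.
Qed.

(** For t = m-2 and t = m-1 there is no order 2^(t+3) left, so no sign; these valuations comprise 2
    and 1 values of k. The last term is k = 0. *)
Lemma sum_Us_values m n : (3 <= m < M)%N ->
  \sum_(k < 2 ^ m) (1 + Us m k) ^+ n
  = (\sum_(t < m - 2) 2 ^+ (m - t - 2) * ((Xv t + Yv t) ^+ n + (Xv t - Yv t) ^+ n)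
     + 2 * Xv (m - 2) ^+ n + Xv (m - 1) ^+ n + Lv m ^+ n)%:~R.
Proof.
move=> /andP[m3 mM].
rewrite (sum_by_two_adic_valuation (fun k => (1 + Us m k) ^+ n)).
rewrite Us_low // addrA subrr add0r.
transitivity ((Lv m ^+ n + \sum_(t < m) \sum_(i < 2 ^ (m - t.+1))
    Sv m t (2 * i).+1 ^+ n)%:~R : algC).
  rewrite rmorphD rmorphXn /=; congr (_ + _).
  rewrite rmorph_sum /=; apply: eq_bigr => t _.
  rewrite rmorph_sum /=; apply: eq_bigr => i _.
  by rewrite rmorphXn /= (@Us_value m t) //= oddM.
congr (_%:~R); rewrite addrC; congr (_ + _).
have [d md] : exists d, m = d.+2 by exists (m - 2)%N; move: m3; clear; lia.
rewrite md !big_ord_recr /= subnn subSnn (_ : d.+2 - 2 = d)%N; last by clear; lia.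
rewrite (_ : d.+2 - 1 = d.+1)%N; last by clear; lia.
rewrite expn0 expn1 big_ord1 !big_ord_recl !big_ord0 addr0.
congr (_ + _ + _).
- by apply: eq_bigr => t _; rewrite sum_odd_part //; have := ltn_ord t; clear; lia.
- by rewrite !Sv_small; [rewrite /Xv; ring | clear; lia | clear; lia].
by rewrite Sv_small //; clear; lia.
Qed.

End Values.
End TwoPowerCharacters.
(** The rational part of G_r. Below 3 it is - sqrt q: A_2 belongs to the Jacobi sum and not to
    G_2. *)
Definition alpha (p s : nat) (A : nat -> int) (r : nat) : int :=
  if (r < 3)%N then - (p ^ s./2)%N%:Z else (gauss_scale p s r)%:Z * A r.

Definition beta (p s : nat) (B : nat -> int) (r : nat) : int :=
  (gauss_scale p s r)%:Z * B r.

Lemma diagonal_count_eval (F : finFieldType) (p s m n : nat) (A B : nat -> int)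
    (al := alpha p s A) (be := beta p s B) :
  prime p -> (p %% 8 = 3)%N -> #|F| = (p ^ s)%N -> (3 <= m)%N ->
  (2 ^ m.+1 %| p ^ s - 1)%N ->
  (forall r, (2 <= r <= m)%N ->
    [/\ (p ^ (s %/ 2 ^ (r - 2)))%N%:Z = A r ^+ 2 + 2 * B r ^+ 2,
        exists k, A r = 4 * k - 1 & ~~ (p %| A r)%Z]) ->
  2 ^+ m * ((p ^ s)%N%:Z *
    #|[set x : {ffun 'I_n -> F} | \sum_(i < n) x i ^+ (2 ^ m) == 0]|%:Z
    - (p ^ s)%N%:Z ^+ n)
  = ((p ^ s)%N%:Z - 1) *
    (\sum_(t < m - 2) 2 ^+ (m - t - 2)
       * ((Xv al t + Yv be t) ^+ n + (Xv al t - Yv be t) ^+ n)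
     + 2 * Xv al (m - 2) ^+ n + Xv al (m - 1) ^+ n + Lv al m ^+ n).
Proof.
move=> p_pr p8 cardF m3 Mdiv hAB.
have [g gP] := finField_generator F.
have [z zP] := C_prim_root_exists (expn_gt0 2 m.+1 : 0 < 2 ^ m.+1)%N.
have [zeta zetaP] := C_prim_root_exists (prime_gt0 p_pr).
have [tr [trD trX trM tr1]] := finField_trace p_pr cardF.
have M4 : (4 <= m.+1)%N by [].
pose w := sqrtm2 m.+1 z; pose G' := G m.+1 g z zeta tr.
(* The sign with which B_r enters G_r depends on the chosen roots of unity; testing the equality
   makes it a function of r. *)
pose e r : int :=
  if G' r == (gauss_scale p s r)%:R * ((A r)%:~R + (B r)%:~R * w) then 1 else -1.
have e1 r : e r = 1 \/ e r = -1 by rewrite /e; case: ifP; auto.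
have GE r : (3 <= r < m.+1)%N ->
    G' r = (al r)%:~R + (beta p s (fun r => e r * B r) r)%:~R * w.
  move=> r3; have [|e0 he0 hE] := @Hs_value _ _ _ _ p_pr p8 cardF M4 Mdiv g z zeta tr
     gP zP zetaP trD trX trM tr1 A B hAB r; first by move: r3; clear; lia.
  rewrite /Hs (_ : (r == 2)%N = false) in hE; last by move: r3; clear; lia.
  rewrite -/G' -/w rmorphM /= in hE.
  rewrite /al /alpha ltnNge (_ : (3 <= r)%N) /=; last by case/andP: r3.
  rewrite /beta !rmorphM /= -mulrA -mulrDr -!pmulrn {1}/e.
  case: ifP => [/eqP -> |]; first by rewrite mul1r.
  by rewrite hE; case: he0 => ->; rewrite ?mul1r ?eqxx // mulrA.
have al1 : al 1%N = - (p ^ s./2)%N%:Z by [].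
have al2 : al 2%N = - (p ^ s./2)%N%:Z by [].
have m3' : (3 <= m < m.+1)%N by rewrite m3 ltnSn.
have key := sum_Us_values p_pr p8 cardF M4 Mdiv gP zP zetaP trD trX tr1 al1 al2 GE n m3'.
have := diagonal_count p_pr p8 cardF M4 Mdiv gP zP zetaP trD tr1 n (leqnSn m).
rewrite key => h; apply: (@intr_inj algC).
transitivity ((2 ^ m)%:R * ((p ^ s)%:R *
    #|[set x : {ffun 'I_n -> F} | \sum_(i < n) x i ^+ (2 ^ m) == 0]|%:R
    - (p ^ s)%:R ^+ n) : algC).
  by rewrite rmorphM rmorphB rmorphM !rmorphXn /= -!pmulrn natrX.
rewrite {}h rmorphM rmorphB /= -!pmulrn; congr (_ * _%:~R).
congr (_ + _ + _ + _); apply: eq_bigr => t _; congr (_ * _).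
(* The two n-th powers are exchanged when the sign of B changes. *)
rewrite /Yv /beta /be /beta; case: (e1 t.+3) => ->; first by rewrite mul1r.
by rewrite mulN1r !mulrN opprK addrC.
Qed.

(* Real powers of q and the final formula *)
From mathcomp Require Import all_classical all_reals all_analysis.
Import Order.TTheory GRing.Theory Num.Theory.
Local Open Scope ring_scope.

Lemma powR_nat_pow (R : realType) (p s e : nat) (a : R) :
  s%:R * a = e%:R -> ((p ^ s)%N%:R : R) `^ a = (p ^ e)%N%:R.
Proof.
by move=> sa; rewrite !natrX -!powR_mulrn ?ler0n // -powRrM sa.
Qed.

(* F is a finite field with q = p^s elements; R is the real numbers
   (any realType); powR (`^) gives positive real powers of q. *)
Theorem theorem1 (R : realType) (F : finFieldType) (p s m n : nat)
    (A B : nat -> int)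
    (hp : prime p) (hp8 : (p %% 8 = 3)%N) (hs : (1 <= s)%N)
    (hF : #|F| = (p ^ s)%N)
    (hm : (3 <= m)%N) (hdiv : (2 ^ m.+1 %| p ^ s - 1)%N) (hn : (1 <= n)%N)
    (hAB : forall r : nat, (2 <= r <= m)%N ->
       ((p ^ (s %/ 2 ^ (r - 2)))%N%:Z = A r ^+ 2 + 2 * B r ^+ 2)%R
       /\ (A r = - 1 %[mod 4])%Z
       /\ ~~ (p%:Z %| A r)%Z) :
  let q : R := (p ^ s)%N%:R in
  let N : R := #|[set x : {ffun 'I_n -> F} |
                  \sum_(i < n) x i ^+ (2 ^ m) == 0]|%:R in
  let Ar (r : nat) : R := (A r)%:~R in
  let Br (r : nat) : R := (B r)%:~R in
  let Sm (k : nat) : R := - 3 * q `^ (2^-1)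
      + \sum_(3 <= r < k.+1) (2 ^ (r - 1))%N%:R * Ar r
          * q `^ (((2 ^ (r - 2))%N%:R - 1) / (2 ^ (r - 1))%N%:R) in
  ((m = 3)%N ->
    N = q ^+ (n - 1) + (q - 1) / (8 * q) *
      (2 * ((q `^ (2^-1) + 4 * Br 3%N * q `^ (4^-1)) ^+ n
            + (q `^ (2^-1) - 4 * Br 3%N * q `^ (4^-1)) ^+ n)
       + 2 * q `^ (n%:R / 2)
       + (- 3 * q `^ (2^-1) + 4 * Ar 3%N * q `^ (4^-1)) ^+ n
       + (- 3 * q `^ (2^-1) - 4 * Ar 3%N * q `^ (4^-1)) ^+ n))
  /\
  ((4 <= m)%N ->
    N = q ^+ (n - 1) + (q - 1) / ((2 ^ m)%N%:R * q) *
      ((2 ^ (m - 2))%N%:R *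
          ((q `^ (2^-1) + 4 * Br 3%N * q `^ (4^-1)) ^+ n
           + (q `^ (2^-1) - 4 * Br 3%N * q `^ (4^-1)) ^+ n)
       + (2 ^ (m - 3))%N%:R *
          ((q `^ (2^-1) + 8 * Br 4%N * q `^ (3 / 8)) ^+ n
           + (q `^ (2^-1) - 8 * Br 4%N * q `^ (3 / 8)) ^+ n)
       + \sum_(2 <= t < (m - 3).+1) (2 ^ (m - t - 2))%N%:R *
          ((Sm t - (2 ^ t)%N%:R * Ar t.+1
                  * q `^ (((2 ^ (t - 1))%N%:R - 1) / (2 ^ t)%N%:R)
                + (2 ^ (t + 2))%N%:R * Br (t + 3)%N
                  * q `^ (((2 ^ (t + 1))%N%:R - 1) / (2 ^ (t + 2))%N%:R)) ^+ n
           + (Sm t - (2 ^ t)%N%:R * Ar t.+1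
                  * q `^ (((2 ^ (t - 1))%N%:R - 1) / (2 ^ t)%N%:R)
                - (2 ^ (t + 2))%N%:R * Br (t + 3)%N
                  * q `^ (((2 ^ (t + 1))%N%:R - 1) / (2 ^ (t + 2))%N%:R)) ^+ n)
       + 2 * (Sm (m - 2)%N - (2 ^ (m - 2))%N%:R * Ar (m - 1)%N
                  * q `^ (((2 ^ (m - 3))%N%:R - 1) / (2 ^ (m - 2))%N%:R)) ^+ n
       + (Sm (m - 1)%N - (2 ^ (m - 1))%N%:R * Ar m
                  * q `^ (((2 ^ (m - 2))%N%:R - 1) / (2 ^ (m - 1))%N%:R)) ^+ n
       + (Sm m) ^+ n)).
Proof.
move=> q N Ar Br Sm.
have M4 : (4 <= m.+1)%N by [].
have p0 : (0 < p)%N by apply: prime_gt0.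
have sK := s_halfK hp8 M4 hdiv.
have hQ : q `^ (2^-1) = (p ^ s./2)%N%:R.
  by apply: powR_nat_pow; rewrite -{1}sK natrD; field.
have hc r a b : (2 <= r <= m)%N -> a = (r - 2)%N -> b = (r - 1)%N ->
    q `^ (((2 ^ a)%N%:R - 1) / (2 ^ b)%N%:R) = (gauss_scale p s r)%:R.
  move=> rm -> ->; apply: powR_nat_pow.
  have K := quot_expK hp8 M4 hdiv (ltac:(lia) : (1 <= r < m.+1)%N).
  have L := quot_exp_le hp8 M4 hdiv (ltac:(lia) : (2 <= r < m.+1)%N).
  have e2 : (2 ^ (r - 1) = 2 * 2 ^ (r - 2))%N by rewrite -expnS; congr (2 ^ _)%N; lia.
  have h2 : s./2 = (2 ^ (r - 2) * quot_exp s r)%N.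
    by rewrite {1}K e2 -mulnA mul2n doubleK.
  rewrite {1}K natrB // h2 e2 !natrM.
  have : (2 ^ (r - 2))%N%:R != 0 :> R by rewrite pnatr_eq0 expn_eq0.
  by move: (2 ^ (r - 2))%N (quot_exp s r) => x y x0; field; rewrite x0.
have h4 : q `^ (4^-1) = (gauss_scale p s 3)%:R.
  rewrite -(@hc 3%N 1%N 2%N) ?hm //; congr (_ `^ _).
  by rewrite expn1 (_ : 2 ^ 2 = 4)%N //; field.
have h38 : (4 <= m)%N -> q `^ (3 / 8) = (gauss_scale p s 4)%:R.
  move=> m4; rewrite -(@hc 4%N 2%N 3%N) ?m4 //; congr (_ `^ _).
  by rewrite (_ : 2 ^ 2 = 4)%N // (_ : 2 ^ 3 = 8)%N //; field.
pose al := alpha p s A; pose be := beta p s B.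
have SmE k : (2 <= k <= m)%N -> Sm k = (Lv al k)%:~R.
  move=> km; have k1 : (1 < k.+1)%N by move: km; clear; lia.
  have k2 : (2 < k.+1)%N by move: km; clear; lia.
  (* The constant -3 sqrt q is the contribution of the orders 2 and 4, namely - sqrt q - 2 sqrt
     q. *)
  rewrite /Sm /Lv [in RHS]big_ltn // [in RHS]big_ltn // addrA rmorphD /= hQ.
  congr (_ + _).
    have a1 : al 1%N = - (p ^ s./2)%N%:Z by [].
    have a2 : al 2%N = - (p ^ s./2)%N%:Z by [].
    rewrite a1 a2 expr0 mul1r expr1 rmorphD rmorphM !rmorphN /= -!pmulrn; ring.
  rewrite rmorph_sum /=; apply: eq_big_nat => r /andP[r3 rk].
  rewrite (hc r) //; last by lia.
  rewrite /al /alpha ltnNge r3 /= !rmorphM rmorphXn /= -!pmulrn natrX subn1.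
  by rewrite mulrAC -mulrA.
have XE t : (2 <= t < m)%N -> (Xv al t)%:~R = Sm t - (2 ^ t)%N%:R * Ar t.+1
    * q `^ (((2 ^ (t - 1))%N%:R - 1) / (2 ^ t)%N%:R) :> R.
  move=> tm; rewrite SmE; last by lia.
  have t1 : (t - 1 = t.+1 - 2)%N by move: tm; clear; lia.
  rewrite (hc t.+1 _ _ _ t1); first last.
  - by rewrite subn1.
  - by move: tm; clear; lia.
  rewrite /Xv rmorphB; congr (_ - _).
  rewrite /al /alpha (_ : (t.+1 < 3)%N = false); last by lia.
  by rewrite !rmorphM rmorphXn /= -!pmulrn natrX mulrAC -mulrA.
(* Valuations 0 and 1 both give sqrt q, as -(- sqrt q) and as - sqrt q + 2 sqrt q; they fall outside
   the general pattern with -3 sqrt q. *)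
have X0 : (Xv al 0)%:~R = q `^ (2^-1) :> R.
  by rewrite hQ /Xv /Lv big_geq // /al /alpha /= expr0 mul1r sub0r opprK.
have X1 : (Xv al 1)%:~R = q `^ (2^-1) :> R.
  rewrite hQ /Xv /Lv big_nat1 /al /alpha /= expr0 expr1 mul1r.
  by rewrite rmorphB rmorphM !rmorphN /= -!pmulrn; ring.
have P2 k : (2 ^+ k : int)%:~R = (2 ^ k)%N%:R :> R by rewrite rmorphXn /= natrX.
have YE t : (Yv be t)%:~R = (2 ^ t.+2)%N%:R * Br t.+3 * (gauss_scale p s t.+3)%:R :> R.
  rewrite -P2 /Yv /be /beta; move: (2 ^+ t.+2) => c.
  by rewrite !rmorphM /= -!pmulrn mulrAC -mulrA.
have q0 : q != 0 by rewrite pnatr_eq0 expn_eq0 negb_and -lt0n p0.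
pose T := \sum_(t < m - 2) 2 ^+ (m - t - 2)
       * ((Xv al t + Yv be t) ^+ n + (Xv al t - Yv be t) ^+ n)
     + 2 * Xv al (m - 2) ^+ n + Xv al (m - 1) ^+ n + Lv al m ^+ n.
have main : N = q ^+ (n - 1) + (q - 1) / ((2 ^ m)%N%:R * q) * T%:~R.
  have hAB' r : (2 <= r <= m)%N ->
      [/\ (p ^ (s %/ 2 ^ (r - 2)))%N%:Z = A r ^+ 2 + 2 * B r ^+ 2,
          exists k, A r = 4 * k - 1 & ~~ (p %| A r)%Z].
    move=> rm; have [h1 [/eqP h2 h3]] := hAB r rm; split=> //.
    move: h2; rewrite eqz_mod_dvd => /dvdzP[k hk]; exists k.
    by rewrite mulrC -hk opprK addrK.
  have e := diagonal_count_eval n hp hp8 hF hm hdiv hAB'.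
  have h : (2 ^ m)%N%:R * (q * N - q ^+ n) = (q - 1) * T%:~R.
    have cast (x y : nat) (t k : int) :
        k * (x%:Z * y%:Z - x%:Z ^+ n) = (x%:Z - 1) * t ->
        k%:~R * (x%:R * y%:R - x%:R ^+ n) = (x%:R - 1) * t%:~R :> R.
      move=> /(congr1 (fun x : int => x%:~R : R)).
      by rewrite !rmorphM !rmorphB rmorphM rmorphXn.
    by rewrite -P2; exact: cast e.
  have m0 : (2 ^ m)%N%:R != 0 :> R by rewrite pnatr_eq0 expn_eq0.
  have qn : q ^+ n = q * q ^+ (n - 1) by rewrite -exprS subn1 prednK.
  rewrite qn in h.
  have -> : (q - 1) / ((2 ^ m)%N%:R * q) * T%:~R
      = (2 ^ m)%N%:R * (q * N - q * q ^+ (n - 1)) / ((2 ^ m)%N%:R * q).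
    by rewrite h mulrAC.
  by field; rewrite m0 q0.
pose X t : R := (Xv al t)%:~R; pose Y t : R := (Yv be t)%:~R.
have TE : T%:~R = \sum_(t < m - 2) (2 ^ (m - t - 2))%N%:R
       * ((X t + Y t) ^+ n + (X t - Y t) ^+ n)
     + 2 * X (m - 2)%N ^+ n + X (m - 1)%N ^+ n + (Lv al m)%:~R ^+ n :> R.
  rewrite /T 3!rmorphD /=; congr (_ + _ + _ + _); try by rewrite rmorphXn.
    rewrite rmorph_sum /=; apply: eq_bigr => t _; rewrite rmorphM /= P2 rmorphD /= !rmorphXn /=.
    by congr (_ * (_ ^+ n + _ ^+ n)); [exact: rmorphD | exact: rmorphB].
  by rewrite rmorphM rmorphXn.
rewrite main TE -SmE; last by rewrite (ltnW hm) leqnn.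
split=> hm'.
  have -> : q `^ (n%:R / 2) = X 1%N ^+ n.
    by rewrite /X X1 -powR_mulrn ?powR_ge0 // -powRrM mulrC.
  have e8 : (2 ^ m)%N = 8%N by rewrite hm'.
  rewrite e8; congr (_ + _ * _).
  rewrite hm' big_ord1.
  rewrite [LHS](_ : _ = 2 * ((X 0%N + Y 0%N) ^+ n + (X 0%N - Y 0%N) ^+ n)
    + 2 * X 1%N ^+ n + X 2%N ^+ n + Sm 3%N ^+ n) //.
  have m23 : (2 <= 2 < m)%N by rewrite hm'.
  have X2 := XE 2%N m23.
  rewrite /X /Y X0 X1 X2 YE h4.
  rewrite /Sm big_nat1 big_geq // addr0.
  rewrite (hc 3%N) ?hm' //.
  by rewrite [LHS]addrAC.
congr (_ + _ * _); have m4 := h38 hm'.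
have d2 : (0 < m - 2)%N by move: hm'; clear; lia.
have d1 : (1 < m - 2)%N by move: hm'; clear; lia.
have XA : X (m - 2)%N = Sm (m - 2)%N - (2 ^ (m - 2))%N%:R * Ar (m - 1)%N
    * q `^ (((2 ^ (m - 3))%N%:R - 1) / (2 ^ (m - 2))%N%:R).
  rewrite /X XE; last by move: hm'; clear; lia.
  rewrite (_ : (m - 2).+1 = m - 1)%N; last by move: hm'; clear; lia.
  by rewrite -subnDA.
have XB : X (m - 1)%N = Sm (m - 1)%N - (2 ^ (m - 1))%N%:R * Ar m
    * q `^ (((2 ^ (m - 2))%N%:R - 1) / (2 ^ (m - 1))%N%:R).
  rewrite /X XE; last by move: hm'; clear; lia.
  rewrite (_ : (m - 1).+1 = m)%N; last by move: hm'; clear; lia.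
  by rewrite -subnDA.
rewrite XA XB; congr (_ + _ + _ + _).
(* Splitting off t = 0 and t = 1 yields the lines with B_3 and B_4; the rest is the sum from t =
   2. *)
rewrite -(big_mkord xpredT (fun t => (2 ^ (m - t - 2))%N%:R
  * ((X t + Y t) ^+ n + (X t - Y t) ^+ n))) big_ltn // big_ltn // addrA.
rewrite (_ : (m - 3).+1 = m - 2)%N; last by move: hm'; clear; lia.
congr (_ + _ + _).
- by rewrite /X /Y X0 YE h4 subn0.
- by rewrite /X /Y X1 YE m4 -subnDA.
apply: eq_big_nat => t /andP[t2 tm].
have tm' : (2 <= t < m)%N by rewrite t2 (leq_trans tm) // leq_subr.
rewrite /X /Y XE // YE addn3 addn2 addn1 (hc t.+3 t.+1 t.+2) //.
by move: tm; clear; lia.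
Qed.
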